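(* There is an absolute constant $C$ such that for every integer $N\ge2$ and real $\Delta>0$ there is a pair $(E,D)$, $E:\mathcal P([N])\times[N]\to\{0,1\}^*$, $D:\mathcal P([N])\times\{0,1\}^*\to[N]$, with $D(Q,E(P,m))=m$ for all $\Delta$-close $P,Q\in\mathcal P([N])$ and all $m\in[N]$ (zero error), such that: for every $P\in\mathcal F=\mathrm{Flat}_N\cup\mathrm{Geo}_N\cup\mathrm{Bin}_N$, $\mathbb E_{m\sim P}[|E(P,m)|]\le C\,2^{H(P)}\lceil\Delta\log^*N\rceil$; and moreover, for every $P\in\mathcal P([N])$ that is $(\Delta\log^*N)$-close to some $\tilde P\in\mathcal F$, $\mathbb E_{m\sim P}[|E(P,m)|]\le C\,2^{H(\tilde P)}\lceil\Delta\log^*N\rceil$.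
   Context: $\mathcal P([N])$ is the set of probability distributions on $[N]=\{1,\dots,N\}$; $\{0,1\}^*$ is the set of finite binary strings. $P,Q$ are $\Delta$-close if for all $m$, $\log_2(P(m)/Q(m))\le\Delta$ and $\log_2(Q(m)/P(m))\le\Delta$. $H(P)=\sum_mP(m)\log_2(1/P(m))$. $\log^*N$ is the least integer $i$ such that the $i$-fold iterated base-2 logarithm of $N$ is at most $1$. $\mathrm{Flat}_N$: distributions uniform on some subset of $[N]$. $\mathrm{Geo}_N$: distributions for which there are $\alpha\in(0,1)$ and a permutation $\pi$ of $[N]$ with $P(\pi(k+1))=\alpha P(\pi(k))$ for all $k\in[N-1]$. $\mathrm{Bin}_N$: distributions for which there are $p\in(0,1)$ and a bijection $\pi:\{0,\dots,N-1\}\to[N]$ with $P(\pi(k))=\binom{N-1}{k}p^k(1-p)^{N-1-k}$. *)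

(* Defs.v *)
From Stdlib Require Import Reals Lra Lia List Arith.
Import ListNotations.
Open Scope R_scope.

(* Messages: [N] = {1,...,N}, represented by nat m with 1 <= m <= N.
   A distribution on [N] is a function nat -> R; values outside [N] are ignored. *)
Definition inN (N m : nat) : Prop := (1 <= m <= N)%nat.

Definition sumN (N : nat) (f : nat -> R) : R :=
  fold_right Rplus 0 (map f (seq 1 N)).

Definition is_dist (N : nat) (P : nat -> R) : Prop :=
  (forall m, inN N m -> 0 <= P m) /\ sumN N P = 1.

Definition log2 (x : R) : R := ln x / ln 2.

(* Delta-closeness: log2(P m/Q m) <= Delta and log2(Q m/P m) <= Delta for all m,
   written multiplicatively (P m <= 2^Delta Q m and Q m <= 2^Delta P m). *)
Definition close (N : nat) (Delta : R) (P Q : nat -> R) : Prop :=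
  forall m, inN N m -> P m <= Rpower 2 Delta * Q m /\ Q m <= Rpower 2 Delta * P m.

Definition entropy (N : nat) (P : nat -> R) : R :=
  sumN N (fun m => if Req_EM_T (P m) 0 then 0 else P m * log2 (/ P m)).

(* log* : least i such that the i-fold iterated log2 of x is <= 1 (fuel-bounded;
   fuel N suffices for x = N >= 1). *)
Fixpoint log_star_aux (fuel : nat) (x : R) : nat :=
  match fuel with
  | O => O
  | S f => if Rle_dec x 1 then O else S (log_star_aux f (log2 x))
  end.

Definition log_star (N : nat) : nat := log_star_aux N (INR N).

Definition Rceil (x : R) : R := IZR (- Int_part (- x)).

Definition perm_of (N : nat) (pi : nat -> nat) : Prop :=
  (forall k, inN N k -> inN N (pi k)) /\
  (forall k l, inN N k -> inN N l -> pi k = pi l -> k = l).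

Definition Flat (N : nat) (P : nat -> R) : Prop :=
  is_dist N P /\
  exists S : list nat, S <> [] /\ NoDup S /\ (forall x, In x S -> inN N x) /\
    forall m, inN N m ->
      (In m S -> P m = / INR (length S)) /\ (~ In m S -> P m = 0).

Definition Geo (N : nat) (P : nat -> R) : Prop :=
  is_dist N P /\
  exists (alpha : R) (pi : nat -> nat), 0 < alpha < 1 /\ perm_of N pi /\
    forall k, (1 <= k <= N - 1)%nat -> P (pi (S k)) = alpha * P (pi k).

Definition Bin (N : nat) (P : nat -> R) : Prop :=
  is_dist N P /\
  exists (p : R) (pi : nat -> nat), 0 < p < 1 /\
    (forall k, (k < N)%nat -> inN N (pi k)) /\
    (forall k l, (k < N)%nat -> (l < N)%nat -> pi k = pi l -> k = l) /\
    forall k, (k < N)%nat ->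
      P (pi k) = Binomial.C (N - 1) k * p ^ k * (1 - p) ^ (N - 1 - k).

Definition inF (N : nat) (P : nat -> R) : Prop := Flat N P \/ Geo N P \/ Bin N P.

Definition exp_len (N : nat) (E : (nat -> R) -> nat -> list bool) (P : nat -> R) : R :=
  sumN N (fun m => P m * INR (length (E P m))).

(* Main.v *)
Require Import Defs.
From Stdlib Require Import Reals List Lra Lia Arith ZArith ClassicalEpsilon.
Import ListNotations.
Open Scope R_scope.

(** Let t = log* N and r = Delta t. To send m, the encoder fixes k with 2^-k about
    P(m) and assigns to each message m' its level, the least j with
    P(m') >= 2^(-k - 2 Delta j), capped at t + 1. Two distributions that are
    Delta-close to the same Q have level vectors differing by at most 1 in every
    coordinate. A vector with d entries of level at most t thus has at most 3^d
    neighbours, and t rounds of Linial's colour reduction, each of which looks one level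
    further down, shrink the N trivial colours to 2^O(d). Sending k and d in unary,
    and then the colour of m, costs k + O(d) bits.

    Flat, geometric and binomial distributions Pt are log-concave up to a
    permutation. If 1/w is the maximum of Pt, then w <= 2^H(Pt), and in the order of
    that permutation Pt halves after every O(w) steps away from the maximum. So, when
    P is r-close to Pt, d = O(w (x + r + 1)) with x = log2 (1 / (w Pt(m))), and the
    mean of x under P is O(r + 1) because of the geometric decay. *)

(** * Separating moduli *)

(** The fraction a! b! / (a+b+1)! is an entry of Leibniz's harmonic triangle. In row b the outer
    entry is 1/(b+1), which z clears by hypothesis, and the entry for (a+1, b) is the one for (a, b)
    minus the one for (a, b+1), so integrality spreads inwards by induction on a. *)
Lemma leibniz_triangle_integral (L z : nat) :
  (forall i, (1 <= i <= L)%nat -> Nat.divide i z) ->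
  forall a b, (a + b + 1 <= L)%nat ->
  exists q : Z,
    IZR q * INR (fact (a + b + 1)) = INR z * INR (fact a) * INR (fact b).
Proof.
  intros Hdiv a; induction a as [|a IH]; intros b Hab.
  - destruct (Hdiv (b + 1)%nat ltac:(lia)) as [q Hq].
    exists (Z.of_nat q).
    rewrite <- INR_IZR_INZ, Hq, Nat.add_0_l, Nat.add_1_r.
    change (fact (S b)) with (S b * fact b)%nat.
    rewrite !mult_INR. simpl (fact 0). change (INR 1) with 1. ring.
  - destruct (IH b ltac:(lia)) as [q1 H1].
    destruct (IH (S b) ltac:(lia)) as [q2 H2].
    exists (q1 - q2)%Z. rewrite minus_IZR.
    replace (a + S b + 1)%nat with (S (a + b + 1)) in H2 by lia.
    replace (S a + b + 1)%nat with (S (a + b + 1)) by lia.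
    change (fact (S (a + b + 1)))
      with (S (a + b + 1) * fact (a + b + 1))%nat in *.
    change (fact (S b)) with (S b * fact b)%nat in *.
    change (fact (S a)) with (S a * fact a)%nat in *.
    rewrite !mult_INR in *.
    assert (Hs : INR (S (a + b + 1)) = INR (S a) + INR (S b)).
    { rewrite <- plus_INR. f_equal. lia. }
    rewrite Rmult_minus_distr_r, H2, Hs.
    replace (IZR q1 * ((INR (S a) + INR (S b)) * INR (fact (a + b + 1))))
      with ((INR (S a) + INR (S b)) * (IZR q1 * INR (fact (a + b + 1)))) by ring.
    rewrite H1. ring.
Qed.

Lemma sum_binomials (n : nat) : sum_f_R0 (Binomial.C n) n = 2 ^ n.
Proof.
  replace 2 with (1 + 1) by ring. rewrite binomial.
  apply sum_eq. intros i Hi. rewrite !pow1. ring.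
Qed.

(* Row n of Leibniz's harmonic triangle shows that (n + 1) C(n, k) divides z; sum
   over k. *)
Lemma common_multiple_ge_pow2 (n z : nat) :
  (0 < z)%nat -> (forall i, (1 <= i <= n + 1)%nat -> Nat.divide i z) ->
  (2 ^ n <= z)%nat.
Proof.
  intros Hz Hdiv.
  assert (Hk : forall k, (k <= n)%nat -> INR (n + 1) * Binomial.C n k <= INR z).
  { intros k Hk.
    destruct (leibniz_triangle_integral (n + 1) z Hdiv k (n - k) ltac:(lia))
      as [q Hq].
    replace (k + (n - k) + 1)%nat with (S n) in Hq by lia.
    change (fact (S n)) with (S n * fact n)%nat in Hq.
    rewrite mult_INR in Hq. replace (n + 1)%nat with (S n) by lia.
    unfold Binomial.C.
    pose proof (INR_fact_lt_0 k). pose proof (INR_fact_lt_0 (n - k)).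
    pose proof (INR_fact_lt_0 n). pose proof (lt_0_INR z Hz).
    pose proof (lt_0_INR (S n) ltac:(lia)).
    assert (Hpos : 0 < INR (fact k) * INR (fact (n - k)))
      by (apply Rmult_lt_0_compat; auto).
    assert (Hpos' : 0 < INR (S n) * INR (fact n))
      by (apply Rmult_lt_0_compat; auto).
    (* A positive integer is at least 1; here integrality becomes the lower bound on z. *)
    assert (Hq1 : 1 <= IZR q).
    { apply IZR_le. apply Z.lt_pred_le. simpl. apply lt_IZR.
      apply Rmult_lt_reg_r with (1 := Hpos').
      rewrite Hq, Rmult_0_l, Rmult_assoc. apply Rmult_lt_0_compat; auto. }
    apply Rmult_le_reg_r with (1 := Hpos).
    replace (INR (S n) * (INR (fact n) / (INR (fact k) * INR (fact (n - k)))) *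
             (INR (fact k) * INR (fact (n - k))))
      with (INR (S n) * INR (fact n)) by (field; lra).
    nra. }
  apply INR_le. rewrite pow_INR. change (INR 2) with 2.
  rewrite <- sum_binomials.
  pose proof (lt_0_INR (n + 1) ltac:(lia)) as Hn.
  apply Rmult_le_reg_l with (1 := Hn).
  rewrite scal_sum.
  replace (INR (n + 1) * INR z) with (sum_f_R0 (fun _ => INR z) n).
  - apply sum_Rle. intros k Hle. rewrite Rmult_comm. auto.
  - rewrite sum_cte. replace (S n) with (n + 1)%nat by lia. ring.
Qed.

(** Subtraction is truncated, so one summand vanishes and each factor is |x - y|. *)
Definition dist_prod (x : nat) (l : list nat) : nat :=
  fold_right (fun y acc => ((x - y) + (y - x)) * acc)%nat 1%nat l.

Lemma dist_prod_pos (x : nat) (l : list nat) : ~ In x l -> (0 < dist_prod x l)%nat.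
Proof.
  induction l as [|y l IH]; simpl; intros H; [lia|].
  apply Nat.mul_pos_pos; [|apply IH; tauto].
  assert (y <> x) by tauto. lia.
Qed.

Lemma dist_prod_le (x B : nat) (l : list nat) :
  (x < B)%nat -> (forall y, In y l -> (y < B)%nat) ->
  (dist_prod x l <= B ^ length l)%nat.
Proof.
  intros Hx. induction l as [|y l IH]; simpl; intros H; [lia|].
  apply Nat.mul_le_mono; [|apply IH; auto].
  specialize (H y (or_introl eq_refl)). lia.
Qed.

Lemma mod_eq_divide_dist (p x y : nat) :
  (1 <= p)%nat -> (y mod p = x mod p)%nat -> Nat.divide p ((x - y) + (y - x)).
Proof.
  intros Hp E.
  pose proof (Nat.div_mod_eq x p) as Hx. pose proof (Nat.div_mod_eq y p) as Hy.
  rewrite E in Hy.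
  exists ((x / p - y / p) + (y / p - x / p))%nat.
  destruct (Nat.le_ge_cases (x / p) (y / p)); nia.
Qed.

Lemma mod_eq_divide_dist_prod (p x : nat) (l : list nat) (y : nat) :
  (1 <= p)%nat -> In y l -> (y mod p = x mod p)%nat ->
  Nat.divide p (dist_prod x l).
Proof.
  intros Hp. induction l as [|a l IH]; simpl; [tauto|].
  intros [->|H] E.
  - apply Nat.divide_mul_l. apply mod_eq_divide_dist; auto.
  - apply Nat.divide_mul_r. auto.
Qed.

(* The least integer not dividing the product of the differences x - y works; it
   need not be prime. *)
Lemma separating_modulus (D b x : nat) (l : list nat) :
  ~ In x l -> (length l <= D)%nat -> (x < 2 ^ b)%nat ->
  (forall y, In y l -> (y < 2 ^ b)%nat) ->
  exists p, (1 <= p <= D * b + 2)%nat /\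
    forall y, In y l -> (y mod p <> x mod p)%nat.
Proof.
  intros Hx Hl Hb Hlb. apply NNPP. intros Hno.
  (* If no modulus up to D b + 2 separates, all of them divide the product, which is then at least
     2^(D b + 1). But it has at most D factors below 2^b. *)
  assert (Hall : forall i, (1 <= i <= (D * b + 1) + 1)%nat ->
                   Nat.divide i (dist_prod x l)).
  { intros i Hi. apply NNPP. intros Hd. apply Hno. exists i. split; [lia|].
    intros y Hy E. apply Hd. eapply mod_eq_divide_dist_prod; eauto. lia. }
  apply common_multiple_ge_pow2 in Hall; [|apply dist_prod_pos; auto].
  pose proof (dist_prod_le x (2 ^ b) l Hb Hlb) as Hup.
  rewrite <- Nat.pow_mul_r in Hup.
  assert (2 ^ (b * length l) <= 2 ^ (D * b))%nat by (apply Nat.pow_le_mono_r; nia).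
  rewrite Nat.pow_add_r in Hall.
  assert (0 < 2 ^ (D * b))%nat by (apply Nat.neq_0_lt_0, Nat.pow_nonzero; lia).
  simpl in Hall. lia.
Qed.

(** * Colour reduction on level vectors *)

Definition adj : list nat -> list nat -> Prop :=
  Forall2 (fun a b => (a <= S b)%nat /\ (b <= S a)%nat).

Definition cnt (i : nat) (v : list nat) : nat :=
  length (filter (fun a => (a <=? i)%nat) v).

(** Here i is the horizon, equal to the number of rounds still available. The entry [S i] is the cap
    and stands for every level beyond the horizon; at most d entries lie below it. *)
Definition valid (N d i : nat) (v : list nat) : Prop :=
  length v = N /\ Forall (fun a => (a <= S i)%nat) v /\ (cnt i v <= d)%nat.

Definition trunc (i : nat) (v : list nat) : list nat :=
  map (fun a => Nat.min a (S i)) v.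

(** The values, capped at [S i], that a neighbour may have where v has a. If a exceeds [S i], the
    neighbour is at the cap whatever it does. Hence only the entries up to [S i] branch, and looking
    at neighbours costs one unit of horizon. *)
Definition opts (i a : nat) : list nat :=
  if (a <=? S i)%nat then [pred a; a; Nat.min (S a) (S i)] else [S i].

Fixpoint nbrs (i : nat) (v : list nat) : list (list nat) :=
  match v with
  | [] => [[]]
  | a :: v' => flat_map (fun b => map (cons b) (nbrs i v')) (opts i a)
  end.

Lemma in_nbrs (i : nat) (v u : list nat) :
  In u (nbrs i v) <-> Forall2 (fun a b => In b (opts i a)) v u.
Proof.
  revert u. induction v as [|a v IH]; intros u; cbn [nbrs].
  - split.
    + intros [<-|[]]. constructor.
    + intros H; inversion H; subst; left; reflexivity.
  - rewrite in_flat_map. split.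
    + intros (b & Hb & Hu). apply in_map_iff in Hu.
      destruct Hu as (u' & <- & Hu'). constructor; auto. apply IH; auto.
    + intros H; inversion H; subst. eexists; split; [eassumption|].
      apply in_map. apply IH; auto.
Qed.

Lemma flat_map_length_le {A B : Type} (f : A -> list B) (l : list A) (c : nat) :
  (forall x, In x l -> (length (f x) <= c)%nat) ->
  (length (flat_map f l) <= length l * c)%nat.
Proof.
  induction l as [|a l IH]; simpl; intros H; [lia|].
  rewrite length_app. specialize (IH (fun x Hx => H x (or_intror Hx))).
  specialize (H a (or_introl eq_refl)). lia.
Qed.

Lemma nbrs_length (i : nat) (v : list nat) :
  (length (nbrs i v) <= 3 ^ cnt (S i) v)%nat.
Proof.
  induction v as [|a v IH]; [simpl; lia|].
  cbn [nbrs].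
  pose proof (flat_map_length_le (fun b => map (cons b) (nbrs i v)) (opts i a)
                (3 ^ cnt (S i) v)) as H.
  assert (H' := H ltac:(intros; cbv beta; rewrite length_map; exact IH)). clear H.
  unfold opts, cnt in *. cbn [filter].
  destruct (a <=? S i)%nat; cbn [length] in *; rewrite ?Nat.pow_succ_r'; lia.
Qed.

Lemma adj_trunc_nbrs (i : nat) (v w : list nat) :
  adj v w -> In (trunc i w) (nbrs i v).
Proof.
  intros H. apply in_nbrs. induction H as [|a b v w [Hab Hba] _ IH];
    cbn [trunc map]; constructor; auto.
  unfold opts. destruct (Nat.leb_spec a (S i)); simpl.
  - assert (b = pred a \/ b = a \/ b = S a) as [->|[->| ->]] by lia; lia.
  - lia.
Qed.

Lemma nbrs_adj_trunc (i : nat) (v u : list nat) :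
  In u (nbrs i v) -> adj (trunc i v) u.
Proof.
  intros H. apply in_nbrs in H. induction H as [|a b v u Hab _ IH];
    cbn [trunc map]; constructor; auto.
  unfold opts in Hab. destruct (Nat.leb_spec a (S i)); simpl in Hab; lia.
Qed.

Lemma cnt_Forall2_le (i j : nat) (v u : list nat) :
  Forall2 (fun a b => (b <= j)%nat -> (a <= i)%nat) v u -> (cnt j u <= cnt i v)%nat.
Proof.
  unfold cnt. induction 1 as [|a b v u Hab _ IH]; simpl; [lia|].
  destruct (Nat.leb_spec b j), (Nat.leb_spec a i); simpl; lia.
Qed.

(** The same d survives the loss of one unit of horizon: an entry of u is at most i only where that
    of v is at most [S i]. *)
Lemma nbrs_valid (N d i : nat) (v u : list nat) :
  valid N d (S i) v -> In u (nbrs i v) -> valid N d i u.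
Proof.
  intros (Hl & Hf & Hc) H. apply in_nbrs in H. repeat split.
  - rewrite <- Hl. symmetry. eapply Forall2_length; eauto.
  - clear -H. induction H as [|a b v u Hab _ IH]; constructor; auto.
    unfold opts in Hab. destruct (Nat.leb_spec a (S i)); simpl in Hab; lia.
  - eapply Nat.le_trans; [|exact Hc]. apply cnt_Forall2_le.
    eapply Forall2_impl; [|exact H]. intros a b Hab Hb.
    unfold opts in Hab. destruct (Nat.leb_spec a (S i)); simpl in Hab; lia.
Qed.

Lemma adj_refl (v : list nat) : adj v v.
Proof. induction v; constructor; auto; lia. Qed.

Lemma trunc_valid (N d i : nat) (v : list nat) :
  valid N d (S i) v -> valid N d i (trunc i v).
Proof. intros H. eapply nbrs_valid; eauto. apply adj_trunc_nbrs, adj_refl. Qed.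

(** The default 1 makes [nth j v 1 = 0] imply that j is in range. It is also fixed by the cap, so
    [map_nth] applies directly. *)
Lemma nth_trunc_zero (i j : nat) (v : list nat) :
  nth j v 1%nat = 0%nat -> nth j (trunc i v) 1%nat = 0%nat.
Proof.
  intros H. unfold trunc.
  pose proof (map_nth (fun a => Nat.min a (S i)) v 1%nat j) as E.
  rewrite H, (Nat.min_l 1) in E by lia. exact E.
Qed.

Lemma zero_positions_le_cnt (i : nat) (u : list nat) (q : nat -> bool) :
  (length (filter (fun k => andb (q k) (nth k u 1 =? 0))%nat (seq 0 (length u)))
   <= cnt i u)%nat.
Proof.
  assert (E : u = map (fun k => nth k u 1%nat) (seq 0 (length u))).
  { apply nth_ext with (d := 1%nat) (d' := 1%nat).
    - now rewrite length_map, length_seq.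
    - intros n Hn. rewrite nth_indep with (d := 1%nat) (d' := nth 0 u 1%nat)
        (n := n) (l := map _ _) by (now rewrite length_map, length_seq).
      rewrite (map_nth (fun k => nth k u 1%nat)), seq_nth by auto. reflexivity. }
  (* With u written as the list of its own entries, the claim generalises to any list of positions
     and yields to induction. *)
  enough (H : forall l, (length (filter (fun k => andb (q k) (nth k u 1 =? 0)%nat) l)
                <= cnt i (map (fun k => nth k u 1%nat) l))%nat)
    by (specialize (H (seq 0 (length u))); rewrite <- E in H; exact H).
  clear E. unfold cnt. induction l as [|k l IH]; simpl; [lia|].
  destruct (Nat.eqb_spec (nth k u 1%nat) 0) as [E|E].
  - rewrite E. simpl. destruct (q k); simpl; lia.
  - rewrite Bool.andb_false_r. destruct (nth k u 1 <=? i)%nat; simpl; lia.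
Qed.

(** Bit length of a colour after i rounds. From b bits, a round produces a modulus p with p + 1 at
    most 8^d (b + 3) and a residue below p. Storing them as p*p + r squares that bound, which gives
    the exponent 2 (3 d + log2 (b + 3)), with the logarithm rounded up. *)
Fixpoint bits (N d i : nat) : nat :=
  match i with
  | O => N
  | S i' => 6 * d + 2 * Nat.log2_up (bits N d i' + 3)
  end.

(** At most 3^d neighbours with at most d coloured messages each must be avoided. The base 8 makes
    the bound a power of 2. *)
Lemma mul_pow3_le_pow8 (d : nat) : (3 ^ d * d <= 8 ^ d)%nat.
Proof.
  induction d as [|d IH]; [simpl; lia|].
  rewrite !Nat.pow_succ_r'.
  assert (3 ^ d <= 8 ^ d)%nat by (apply Nat.pow_le_mono_l; lia).
  assert (1 <= 3 ^ d)%nat by (apply Nat.neq_0_lt_0, Nat.pow_nonzero; lia).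
  nia.
Qed.

(** Since r < p, the number p*p + r lies between p^2 and (p+1)^2, so p is its integer square
    root. *)
Lemma square_plus_inj (p q r s : nat) :
  (r < p)%nat -> (s < q)%nat -> (p * p + r = q * q + s)%nat -> p = q /\ r = s.
Proof.
  intros Hr Hs E.
  assert (p = q) by (destruct (Nat.lt_trichotomy p q) as [|[|]]; nia).
  subst. split; lia.
Qed.

(* Linial's colour reduction: a colour is replaced by a modulus that separates
   it from the colours of all neighbours, together with its residue. *)
Lemma coloring_exists (N d i : nat) :
  exists c : list nat -> nat -> nat,
    (forall v j, valid N d i v -> nth j v 1%nat = 0%nat ->
       (c v j < 2 ^ bits N d i)%nat) /\
    (forall v w j k, valid N d i v -> valid N d i w -> adj v w ->
       nth j v 1%nat = 0%nat -> nth k w 1%nat = 0%nat -> j <> k ->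
       c v j <> c w k).
Proof.
  induction i as [|i (c & Hb & Hc)].
  - exists (fun _ j => j). split; auto. intros v j (Hl & _) Hj. simpl.
    assert (j < length v)%nat.
    { destruct (Nat.lt_ge_cases j (length v)) as [|Hge]; auto.
      rewrite nth_overflow in Hj by auto. discriminate. }
    assert (N < 2 ^ N)%nat by (apply Nat.pow_gt_lin_r; lia). lia.
  (* The old colours of all messages other than j that have level 0 in some possible neighbour of v.
     The list depends on v and j only, and so does the modulus [md v j] chosen to avoid it. *)
  - set (nc := fun v j => flat_map (fun u => map (c u)
       (filter (fun k => andb (negb (k =? j)%nat) (nth k u 1 =? 0)%nat) (seq 0 N)))
       (nbrs i v)).
    set (b := bits N d i) in *.
    set (sep := fun v j p => (1 <= p <= 8 ^ d * b + 2)%nat /\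
       forall y, In y (nc v j) -> (y mod p <> c (trunc i v) j mod p)%nat).
    set (md := fun v j => epsilon (inhabits 0%nat) (sep v j)).
    assert (Hnc : forall v j y, In y (nc v j) <-> exists u k, In u (nbrs i v) /\
              (k < N)%nat /\ k <> j /\ nth k u 1%nat = 0%nat /\ y = c u k).
    { intros v j y. unfold nc. rewrite in_flat_map. split.
      - intros (u & Hu & Hy). apply in_map_iff in Hy.
        destruct Hy as (k & <- & Hk). apply filter_In in Hk.
        destruct Hk as [Hk1 Hk2]. apply andb_prop in Hk2.
        destruct Hk2 as [Hk2 Hk3]. apply in_seq in Hk1.
        apply Nat.eqb_eq in Hk3. apply Bool.negb_true_iff, Nat.eqb_neq in Hk2.
        exists u, k. repeat split; auto; lia.
      - intros (u & k & Hu & Hk & Hkj & Hz & ->). exists u. split; auto.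
        apply in_map. apply filter_In. split; [apply in_seq; lia|].
        rewrite Hz. apply Nat.eqb_neq in Hkj. rewrite Hkj. reflexivity. }
    assert (Hsep : forall v j, valid N d (S i) v -> nth j v 1%nat = 0%nat ->
              sep v j (md v j)).
    { intros v j Hv Hj. unfold md. apply epsilon_spec.
      apply separating_modulus.
      - rewrite Hnc. intros (u & k & Hu & Hk & Hkj & Hz & E).
        apply (Hc (trunc i v) u j k); auto using trunc_valid, nth_trunc_zero,
          nbrs_adj_trunc. eapply nbrs_valid; eauto.
      - unfold nc. eapply Nat.le_trans; [apply flat_map_length_le with (c := d)|].
        + intros u Hu. rewrite length_map.
          destruct (nbrs_valid _ _ _ _ _ Hv Hu) as (Hl & _ & Hcn).
          eapply Nat.le_trans; [|exact Hcn].
          rewrite <- Hl. apply zero_positions_le_cnt.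
        + eapply Nat.le_trans; [|apply mul_pow3_le_pow8].
          apply Nat.mul_le_mono_r.
          eapply Nat.le_trans; [apply nbrs_length|].
          apply Nat.pow_le_mono_r; [lia|]. apply Hv.
      - apply Hb; auto using trunc_valid, nth_trunc_zero.
      - intros y Hy. apply Hnc in Hy. destruct Hy as (u & k & Hu & _ & _ & Hz & ->).
        apply Hb; auto. eapply nbrs_valid; eauto. }
    exists (fun v j => md v j * md v j + c (trunc i v) j mod md v j)%nat. split.
    + intros v j Hv Hj. destruct (Hsep v j Hv Hj) as [Hm _].
      set (p := md v j) in *.
      assert (Hr : (c (trunc i v) j mod p < p)%nat) by (apply Nat.mod_upper_bound; lia).
      cbn [bits]. fold b.
      replace (6 * d + 2 * Nat.log2_up (b + 3))%nat
        with ((3 * d + Nat.log2_up (b + 3)) * 2)%nat by lia.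
      rewrite Nat.pow_mul_r, Nat.pow_2_r, (Nat.pow_add_r 2 (3 * d)), Nat.pow_mul_r.
      change (2 ^ 3)%nat with 8%nat.
      assert (b + 3 <= 2 ^ Nat.log2_up (b + 3))%nat by (apply Nat.log2_up_spec; lia).
      assert (1 <= 8 ^ d)%nat by (apply Nat.neq_0_lt_0, Nat.pow_nonzero; lia).
      set (B := (8 ^ d * 2 ^ Nat.log2_up (b + 3))%nat).
      assert (p + 1 <= B)%nat by (unfold B; nia).
      nia.
    + intros v w j k Hv Hw Hvw Hj Hk Hjk E.
      destruct (Hsep v j Hv Hj) as [Hp Hps]. destruct (Hsep w k Hw Hk) as [Hq _].
      apply square_plus_inj in E; try (apply Nat.mod_upper_bound; lia).
      (* Equal new colours mean equal moduli and equal residues. But the old colour of k in w,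
         capped, is listed in [nc v j], and the modulus of v separates it from that of j. *)
      destruct E as [E1 E2]. rewrite <- E1 in E2. symmetry in E2. revert E2.
      apply Hps. apply Hnc. exists (trunc i w), k. repeat split; auto.
      * apply adj_trunc_nbrs; auto.
      * destruct Hw as (<- & _). destruct (Nat.lt_ge_cases k (length w)); auto.
        rewrite nth_overflow in Hk by auto. discriminate.
      * apply nth_trunc_zero; auto.
Qed.

(** * Number of colours after log* N rounds *)

Lemma ln2_pos : 0 < ln 2.
Proof. rewrite <- ln_1. apply ln_increasing; lra. Qed.

Lemma log2_le (x y : R) : 0 < x -> x <= y -> log2 x <= log2 y.
Proof.
  intros Hx Hy. unfold log2. apply Rmult_le_compat_r.
  - apply Rlt_le, Rinv_0_lt_compat, ln2_pos.
  - destruct Hy as [Hy| ->]; [left; apply ln_increasing; auto | lra].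
Qed.

Lemma log2_mult (x y : R) : 0 < x -> 0 < y -> log2 (x * y) = log2 x + log2 y.
Proof. intros. unfold log2. rewrite ln_mult by auto. field. pose proof ln2_pos; lra. Qed.

Lemma log2_inv (x : R) : 0 < x -> log2 (/ x) = - log2 x.
Proof. intros. unfold log2. rewrite ln_Rinv by auto. field. pose proof ln2_pos; lra. Qed.

Lemma log2_pow2 (n : nat) : log2 (2 ^ n) = INR n.
Proof. unfold log2. rewrite ln_pow by lra. field. pose proof ln2_pos; lra. Qed.

Lemma log2_1 : log2 1 = 0.
Proof. exact (log2_pow2 0). Qed.

Lemma log2_2 : log2 2 = 1.
Proof. replace 2 with (2 ^ 1) by ring. exact (log2_pow2 1). Qed.

Lemma Rpower2_log2 (x : R) : 0 < x -> Rpower 2 (log2 x) = x.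
Proof.
  intros Hx. unfold Rpower, log2.
  replace (ln x / ln 2 * ln 2) with (ln x) by (field; pose proof ln2_pos; lra).
  apply exp_ln; auto.
Qed.

Lemma log2_Rpower2 (x : R) : log2 (Rpower 2 x) = x.
Proof. unfold log2, Rpower. rewrite ln_exp. field. pose proof ln2_pos; lra. Qed.

Lemma Rpower2_pos (x : R) : 0 < Rpower 2 x.
Proof. apply exp_pos. Qed.

Lemma Rpower2_INR (n : nat) : Rpower 2 (INR n) = 2 ^ n.
Proof. apply Rpower_pow; lra. Qed.

(** Write 2^z as 2 * 2^(z-1), which is at least 2 (1 + (z-1) ln 2), and use ln 2 >= 1/2. *)
Lemma Rpower2_ge_1_plus (z : R) : 1 <= z -> z + 1 <= Rpower 2 z.
Proof.
  intros Hz. pose proof ln2_pos.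
  replace z with (1 + (z - 1)) at 2 by ring.
  rewrite Rpower_plus, Rpower_1 by lra.
  assert (Hl : / 2 <= ln 2) by (apply Rlt_le, ln_lt_2).
  assert (1 + (z - 1) * ln 2 <= Rpower 2 (z - 1)).
  { unfold Rpower. destruct (Req_dec ((z - 1) * ln 2) 0) as [E|E].
    - rewrite E, exp_0. lra.
    - left. apply exp_ineq1; auto. }
  nra.
Qed.

Lemma Rpower2_ge_id (z : R) : z <= Rpower 2 z.
Proof.
  destruct (Rle_lt_dec 1 z) as [H|H].
  - pose proof (Rpower2_ge_1_plus z H). lra.
  - destruct (Rle_lt_dec z 0).
    + pose proof (Rpower2_pos z). lra.
    + apply Rle_trans with 1; [lra|].
      rewrite <- (Rpower_O 2) at 1 by lra. apply Rle_Rpower; lra.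
Qed.

(** Shows that one unit of fuel pays for one logarithm in [log_star_aux]. *)
Lemma log2_le_pred (x : R) : 2 <= x -> log2 x <= x - 1.
Proof.
  intros Hx. rewrite <- (log2_Rpower2 (x - 1)). apply log2_le; [lra|].
  pose proof (Rpower2_ge_1_plus (x - 1)). lra.
Qed.

Lemma log2_le_id (x : R) : 0 < x -> log2 x <= x.
Proof.
  intros Hx. rewrite <- (log2_Rpower2 x) at 2. apply log2_le; auto.
  apply Rpower2_ge_id.
Qed.

Lemma INR_log2_up_le (n : nat) : (1 < n)%nat -> INR (Nat.log2_up n) <= 1 + log2 (INR n).
Proof.
  intros Hn. destruct (Nat.log2_up_spec n Hn) as [H _].
  pose proof (Nat.log2_up_pos n Hn).
  destruct (Nat.log2_up n) as [|k] eqn:E; [lia|]. simpl pred in H.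
  rewrite S_INR. apply lt_INR in H. rewrite pow_INR in H. change (INR 2) with 2 in H.
  assert (INR k <= log2 (INR n)); [|lra].
  rewrite <- log2_pow2. apply log2_le; [apply pow_lt; lra | lra].
Qed.

(** [bits] peels off the last round and [log_star_aux] the first logarithm; this aligns the two
    recursions. *)
Lemma bits_succ_l (b d i : nat) : bits b d (S i) = bits (bits b d 1) d i.
Proof. induction i as [|i IH]; [reflexivity|]. cbn [bits] in *. now rewrite <- IH. Qed.

(** The invariant b <= 25 d + 4 max(x, 1) survives replacing b by one round and x by log2 x, so the
    rounds end when x drops to 1. *)
Lemma bits_log_star_aux (d f : nat) : (1 <= d)%nat -> (1 <= f)%nat ->
  forall x b, x <= INR f -> INR b <= 25 * INR d + 4 * Rmax x 1 ->
  INR (bits b d (log_star_aux f x)) <= 25 * INR d + 4.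
Proof.
  intros Hd. induction f as [|f IH]; intros Hf x b Hx Hb; [lia|].
  cbn [log_star_aux]. destruct (Rle_dec x 1) as [H1|H1].
  - cbn [bits]. rewrite Rmax_right in Hb by auto. lra.
  - assert (Hf1 : (1 <= f)%nat).
    { destruct f; [|lia]. change (INR 1) with 1 in Hx. lra. }
    rewrite bits_succ_l. apply IH; auto.
    + rewrite S_INR in Hx. apply le_INR in Hf1. change (INR 1) with 1 in Hf1.
      destruct (Rle_lt_dec x 2) as [H2|H2].
      * pose proof (log2_le x 2 ltac:(lra) H2) as H. rewrite log2_2 in H. lra.
      * pose proof (log2_le_pred x). lra.
    + rewrite Rmax_left in Hb by lra. cbn [bits].
      rewrite plus_INR, !mult_INR. change (INR 2) with 2.
      replace (INR 6) with 6 by (simpl; ring).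
      assert (HL := INR_log2_up_le (b + 3) ltac:(lia)).
      rewrite plus_INR in HL. replace (INR 3) with 3 in HL by (simpl; ring).
      assert (Hd' : 1 <= INR d) by (apply (le_INR 1); auto).
      pose proof (pos_INR b).
      (* As d and x are at least 1, b + 3 <= (25 + 4 + 3) d x = 2^5 d x. The new bit length is then
         at most 8 d + 12 + 2 log2 x. *)
      assert (log2 (INR b + 3) <= log2 (2 ^ 5 * INR d * x)).
      { apply log2_le; [lra|]. nra. }
      rewrite !log2_mult, log2_pow2 in H0 by (simpl; nra).
      pose proof (log2_le_id (INR d) ltac:(lra)).
      replace (INR 5) with 5 in H0 by (simpl; ring).
      pose proof (Rmax_l (log2 x) 1). pose proof (Rmax_r (log2 x) 1). lra.
Qed.

Lemma bits_log_star (N d : nat) : (1 <= N)%nat -> (1 <= d)%nat ->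
  INR (bits N d (log_star N)) <= 25 * INR d + 4.
Proof.
  intros HN Hd. apply bits_log_star_aux; auto.
  - lra.
  - pose proof (Rmax_l (INR N) 1). pose proof (pos_INR d). pose proof (pos_INR N). lra.
Qed.

(** * The code *)

(** Comparing with the thresholds theta, theta rho, theta rho^2, ... instead of taking a logarithm
    also covers x = 0, which gets the cap n when theta and rho are positive. *)
Fixpoint lev (n : nat) (theta rho x : R) : nat :=
  match n with
  | O => O
  | S n' => if Rle_dec theta x then O else S (lev n' (theta * rho) rho x)
  end.

Lemma lev_le (n : nat) (theta rho x : R) : (lev n theta rho x <= n)%nat.
Proof.
  revert theta. induction n as [|n IH]; intros theta; simpl; [lia|].
  destruct (Rle_dec theta x); [lia|]. specialize (IH (theta * rho)). lia.
Qed.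

Lemma lev_succ_le (n : nat) (theta rho x : R) :
  (lev n theta rho x <= lev (S n) theta rho x)%nat.
Proof.
  revert theta. induction n as [|n IH]; intros theta; [simpl; lia|].
  cbn [lev]. destruct (Rle_dec theta x); [lia|].
  specialize (IH (theta * rho)). cbn [lev] in IH. lia.
Qed.

Lemma lev_scale (n : nat) (theta rho x y : R) : 0 < rho ->
  y * rho <= x -> (lev n (theta * rho) rho x <= lev n theta rho y)%nat.
Proof.
  intros Hr Hxy. revert theta. induction n as [|n IH]; intros theta; simpl; [lia|].
  destruct (Rle_dec theta y), (Rle_dec (theta * rho) x); try lia.
  - exfalso. nra.
  - specialize (IH (theta * rho)). lia.
Qed.

(** Once x has failed the first threshold, its remaining thresholds start at theta rho, and
    [lev_scale] compares them with those of y starting at theta. *)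
Lemma lev_lipschitz (n : nat) (theta rho x y : R) : 0 < rho ->
  y * rho <= x -> (lev n theta rho x <= S (lev n theta rho y))%nat.
Proof.
  intros Hr Hxy. destruct n as [|n]; [simpl; lia|].
  cbn [lev]. destruct (Rle_dec theta x); [lia|].
  pose proof (lev_scale n theta rho x y Hr Hxy).
  pose proof (lev_succ_le n theta rho y). cbn [lev] in *. lia.
Qed.

Lemma lev_zero (n : nat) (theta rho x : R) : theta <= x -> lev n theta rho x = 0%nat.
Proof. intros H. destruct n; simpl; auto. destruct (Rle_dec theta x); tauto. Qed.

Lemma lev_lt_inv (n : nat) (theta rho x : R) : 0 <= theta -> 0 < rho <= 1 ->
  (lev (S n) theta rho x <= n)%nat -> theta * rho ^ n <= x.
Proof.
  intros Ht Hr. revert theta Ht. induction n as [|n IH]; intros theta Ht; cbn [lev].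
  - destruct (Rle_dec theta x); [|lia]. intros _. simpl. lra.
  - destruct (Rle_dec theta x) as [H|H].
    + intros _. pose proof (pow_incr rho 1 (S n) ltac:(lra)). rewrite pow1 in H0. nra.
    + intros Hl. simpl pow. rewrite <- Rmult_assoc. apply IH; [nra|].
      cbn [lev]. lia.
Qed.

Definition level_vector (N t : nat) (theta rho : R) (P : nat -> R) : list nat :=
  map (fun m => lev (S t) theta rho (P m)) (seq 1 N).

Lemma level_vector_adj (N t : nat) (theta rho : R) (P Q : nat -> R) : 0 < rho ->
  (forall m, inN N m -> P m * rho <= Q m /\ Q m * rho <= P m) ->
  adj (level_vector N t theta rho P) (level_vector N t theta rho Q).
Proof.
  intros Hr H. unfold level_vector, inN in *.
  assert (Hin : forall m, In m (seq 1 N) -> P m * rho <= Q m /\ Q m * rho <= P m).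
  { intros m Hm. apply in_seq in Hm. apply H. lia. }
  clear H. unfold adj. induction (seq 1 N) as [|m l IH]; cbn [map]; constructor.
  - destruct (Hin m (or_introl eq_refl)). split; apply lev_lipschitz; auto.
  - apply IH. intros; apply Hin; right; auto.
Qed.

Lemma level_vector_valid (N t : nat) (theta rho : R) (P : nat -> R) :
  let v := level_vector N t theta rho P in valid N (cnt t v) t v.
Proof.
  unfold level_vector. repeat split; [now rewrite length_map, length_seq| |lia].
  apply Forall_forall. intros a Ha. apply in_map_iff in Ha.
  destruct Ha as (m & <- & _). apply lev_le.
Qed.

Lemma level_vector_nth (N t : nat) (theta rho : R) (P : nat -> R) (m : nat) :
  inN N m -> nth (m - 1) (level_vector N t theta rho P) 1%nat = lev (S t) theta rho (P m).
Proof.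
  intros Hm. unfold inN in Hm. unfold level_vector.
  rewrite nth_indep with (d' := lev (S t) theta rho (P 0%nat))
    by (rewrite length_map, length_seq; lia).
  rewrite (map_nth (fun m => lev (S t) theta rho (P m))), seq_nth by lia.
  do 2 f_equal. lia.
Qed.

Lemma level_vector_cnt (N t : nat) (theta rho : R) (P : nat -> R) (p : nat -> bool) :
  0 <= theta -> 0 < rho <= 1 ->
  (forall m, inN N m -> theta * rho ^ t <= P m -> p m = true) ->
  (cnt t (level_vector N t theta rho P) <= length (filter p (seq 1 N)))%nat.
Proof.
  intros Ht Hr Hp. unfold cnt, level_vector.
  assert (Hin : forall m, In m (seq 1 N) -> theta * rho ^ t <= P m -> p m = true).
  { intros m Hm. apply in_seq in Hm. apply Hp. unfold inN. lia. }
  induction (seq 1 N) as [|m l IH]; cbn [map filter]; [lia|].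
  specialize (IH (fun x Hx => Hin x (or_intror Hx))).
  destruct (Nat.leb_spec (lev (S t) theta rho (P m)) t) as [H|H].
  - rewrite (Hin m) by (auto using lev_lt_inv, in_eq). cbn [length]. lia.
  - destruct (p m); cbn [length]; lia.
Qed.

(** The colouring is fixed by N, d and t, so encoders with different distributions but the same d
    share it. *)
Definition color (N d t : nat) : list nat -> nat -> nat :=
  proj1_sig (constructive_indefinite_description _ (coloring_exists N d t)).

(** Self-delimiting. The colour that comes last in a codeword needs no delimiter, as d determines
    its length. *)
Definition unary (n : nat) : list bool := repeat true n ++ [false].

Lemma unary_app_inj (n n' : nat) (l l' : list bool) :
  unary n ++ l = unary n' ++ l' -> n = n' /\ l = l'.
Proof.
  unfold unary. rewrite <- !app_assoc. revert n'.
  induction n as [|n IH]; intros [|n']; simpl; intros E; inversion E; auto.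
  apply IH in H0. destruct H0; auto.
Qed.

Definition binary (b n : nat) : list bool := map (Nat.testbit n) (seq 0 b).

Lemma binary_inj (b n n' : nat) : (n < 2 ^ b)%nat -> (n' < 2 ^ b)%nat ->
  binary b n = binary b n' -> n = n'.
Proof.
  intros Hn Hn' E. unfold binary in E.
  apply Nat.bits_inj. intros i.
  destruct (Nat.lt_ge_cases i b) as [Hi|Hi].
  - exact (ext_in_map E i ltac:(apply in_seq; lia)).
  - rewrite <- (Nat.mod_small n (2 ^ b)), <- (Nat.mod_small n' (2 ^ b)) by auto.
    now rewrite !Nat.mod_pow2_bits_high.
Qed.

Definition threshold_exponent (x : R) : nat := Z.to_nat (up (log2 (/ x))).

(** Messages of probability 0 get their own flag and a long code, which adds nothing to the mean
    length. The level ratio is 2^(-2 Delta) because two encoders close to the same decoder are only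
    2 Delta-close to each other. *)
Definition encode (N : nat) (Delta : R) (P : nat -> R) (m : nat) : list bool :=
  if Rle_dec (P m) 0 then false :: repeat true m
  else
    let t := log_star N in
    let k := threshold_exponent (P m) in
    let v := level_vector N t (/ 2 ^ k) (Rpower 2 (- (2 * Delta))) P in
    let d := cnt t v in
    true :: unary k ++ unary d ++ binary (bits N d t) (color N d t v (m - 1)).

Lemma threshold_exponent_spec (x : R) : 0 < x <= 1 ->
  / 2 ^ threshold_exponent x <= x /\ INR (threshold_exponent x) <= 1 - log2 x.
Proof.
  intros Hx. unfold threshold_exponent. rewrite log2_inv by lra.
  set (y := - log2 x).
  assert (Hy : 0 <= y).
  { unfold y. pose proof (log2_le x 1). rewrite log2_1 in H. lra. }
  destruct (archimed y) as [H1 H2].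
  assert (Hu : (0 <= up y)%Z) by (apply le_IZR; lra).
  assert (E : INR (Z.to_nat (up y)) = IZR (up y)).
  { rewrite INR_IZR_INZ, Z2Nat.id; auto. }
  split; [|rewrite E; unfold y in *; lra].
  rewrite <- Rpower2_INR, E, <- Rpower_Ropp, <- (Rpower2_log2 x) at 1 by lra.
  apply Rle_Rpower; [lra|]. unfold y in *; lra.
Qed.

Lemma sumN_le (N : nat) (f g : nat -> R) :
  (forall m, inN N m -> f m <= g m) -> sumN N f <= sumN N g.
Proof.
  unfold sumN, inN. intros H.
  assert (Hin : forall m, In m (seq 1 N) -> f m <= g m).
  { intros m Hm. apply in_seq in Hm. apply H. lia. }
  clear H. induction (seq 1 N) as [|a l IH]; simpl; [lra|].
  apply Rplus_le_compat; auto with datatypes.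
Qed.

Lemma dist_le_1 (N : nat) (P : nat -> R) (m : nat) : is_dist N P -> inN N m -> P m <= 1.
Proof.
  intros [H0 H1] Hm. rewrite <- H1. clear H1. unfold sumN.
  assert (Hin : forall m, In m (seq 1 N) -> 0 <= P m).
  { intros k Hk. apply in_seq in Hk. apply H0. unfold inN. lia. }
  assert (Hm' : In m (seq 1 N)) by (apply in_seq; unfold inN in Hm; lia).
  clear Hm H0. induction (seq 1 N) as [|a l IH]; [destruct Hm'|].
  simpl. assert (0 <= fold_right Rplus 0 (map P l)).
  { clear IH Hm'. induction l as [|b l IH]; simpl; [lra|].
    pose proof (Hin b ltac:(simpl; auto)).
    assert (0 <= fold_right Rplus 0 (map P l)).
    { apply IH. intros k [->|Hk]; apply Hin; simpl; auto. }
    lra. }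
  destruct Hm' as [->|Hm'].
  - lra.
  - pose proof (Hin a (or_introl eq_refl)).
    specialize (IH (fun k Hk => Hin k (or_intror Hk)) Hm'). lra.
Qed.

(** Equal codewords have equal k and d, so both level vectors use the same thresholds and are valid
    for the same colouring. They are adjacent, and both messages have level 0 by the choice of k;
    distinct messages would thus have distinct colours. *)
Lemma encode_inj (N : nat) (Delta : R) (P P' : nat -> R) (m m' : nat) :
  is_dist N P -> is_dist N P' -> close N (2 * Delta) P P' ->
  inN N m -> inN N m' -> encode N Delta P m = encode N Delta P' m' -> m = m'.
Proof.
  intros HP HP' Hcl Hm Hm'. unfold encode.
  destruct (Rle_dec (P m) 0) as [H0|H0], (Rle_dec (P' m') 0) as [H0'|H0'];
    cbv zeta; intros E; try discriminate.
  - injection E as E. apply (f_equal (@length bool)) in E.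
    now rewrite !repeat_length in E.
  - set (t := log_star N) in *. set (rho := Rpower 2 (- (2 * Delta))) in *.
    injection E as E. apply unary_app_inj in E. destruct E as [Ek E].
    rewrite <- Ek in E.
    set (k := threshold_exponent (P m)) in *.
    set (v := level_vector N t (/ 2 ^ k) rho P) in *.
    set (v' := level_vector N t (/ 2 ^ k) rho P') in *.
    apply unary_app_inj in E. destruct E as [Ed E]. rewrite <- Ed in E.
    set (d := cnt t v) in *.
    assert (Hv : valid N d t v) by apply level_vector_valid.
    assert (Hv' : valid N d t v') by (rewrite Ed; apply level_vector_valid).
    assert (Hz : nth (m - 1) v 1%nat = 0%nat).
    { unfold v. rewrite level_vector_nth by auto. apply lev_zero.
      apply threshold_exponent_spec. split; [lra|]. eapply dist_le_1; eauto. }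
    assert (Hz' : nth (m' - 1) v' 1%nat = 0%nat).
    { unfold v'. rewrite level_vector_nth by auto. apply lev_zero. rewrite Ek.
      apply threshold_exponent_spec. split; [lra|]. eapply dist_le_1; eauto. }
    unfold color in E.
    destruct (constructive_indefinite_description _ (coloring_exists N d t))
      as (c & Hb & Hc). simpl in E.
    apply binary_inj in E; auto.
    destruct (Nat.eq_dec (m - 1) (m' - 1)) as [|Hne].
    { unfold inN in *. lia. }
    exfalso. revert E. apply Hc; auto. unfold v, v'. apply level_vector_adj.
    + apply Rpower2_pos.
    + intros n Hn. destruct (Hcl n Hn) as [Ha Hb'].
      assert (Er : rho * Rpower 2 (2 * Delta) = 1).
      { unfold rho. rewrite <- Rpower_plus, Rplus_opp_l. apply Rpower_O. lra. }
      pose proof (Rpower2_pos (- (2 * Delta))) as Hr. fold rho in Hr.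
      apply (Rmult_le_compat_l rho) in Ha, Hb'; try lra.
      rewrite <- Rmult_assoc, Er, Rmult_1_l, Rmult_comm in Ha, Hb'. auto.
Qed.

Lemma close_trans (N : nat) (D1 D2 : R) (P Q S : nat -> R) :
  close N D1 P Q -> close N D2 Q S -> close N (D1 + D2) P S.
Proof.
  intros H1 H2 m Hm. destruct (H1 m Hm), (H2 m Hm).
  pose proof (Rpower2_pos D1). pose proof (Rpower2_pos D2).
  rewrite Rpower_plus. split.
  - apply Rle_trans with (Rpower 2 D1 * Q m); [tauto|].
    rewrite Rmult_assoc. apply Rmult_le_compat_l; [lra|tauto].
  - apply Rle_trans with (Rpower 2 D2 * Q m); [tauto|].
    rewrite (Rmult_comm (Rpower 2 D1)), Rmult_assoc.
    apply Rmult_le_compat_l; [lra|tauto].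
Qed.

Lemma close_sym (N : nat) (D : R) (P Q : nat -> R) : close N D P Q -> close N D Q P.
Proof. intros H m Hm. destruct (H m Hm). auto. Qed.

(** Searches over all P that are Delta-close to Q. Any two of them are 2 Delta-close, so
    [encode_inj] makes the message unique. *)
Definition decode (N : nat) (Delta : R) (Q : nat -> R) (w : list bool) : nat :=
  epsilon (inhabits 0%nat) (fun m => inN N m /\ exists P, is_dist N P /\
    close N Delta P Q /\ encode N Delta P m = w).

Lemma decode_encode (N : nat) (Delta : R) (P Q : nat -> R) (m : nat) :
  is_dist N P -> close N Delta P Q -> inN N m ->
  decode N Delta Q (encode N Delta P m) = m.
Proof.
  intros HP HPQ Hm. unfold decode.
  match goal with |- epsilon ?i ?X = _ => destruct (epsilon_spec i X) as
    (Hn & P' & HP' & HP'Q & E) end.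
  - exists m. split; eauto.
  - eapply encode_inj with (P := P') (P' := P); eauto.
    replace (2 * Delta) with (Delta + Delta) by ring.
    eapply close_trans; eauto. apply close_sym; auto.
Qed.

(** * Expected length *)

Definition posb (x : R) : bool := if Rlt_dec 0 x then true else false.

(** All that the length estimate uses about the families: the support splits into blocks of O(w)
    messages, and the bound on P halves from each block to the next. *)
Definition block_decay (N : nat) (P : nat -> R) (w : R) : Prop :=
  1 <= w /\ (forall m, inN N m -> P m <= / w) /\
  exists beta : nat -> nat,
    (forall m, inN N m -> 0 < P m -> P m <= / w * (/ 2) ^ beta m) /\
    forall j, INR (length (filter (fun m => andb (posb (P m)) (beta m =? j)%nat)
                             (seq 1 N))) <= 6 * w.

(** With q = 1 this counts the messages in the first n blocks; with q < 1 it is a truncated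
    geometric sum. *)
Definition layer_sum (g : nat -> bool) (beta : nat -> nat) (q : R) (n : nat)
    (l : list nat) : R :=
  fold_right Rplus 0
    (map (fun m => if andb (g m) (beta m <? n)%nat then q ^ beta m else 0) l).

Lemma layer_sum_succ (g : nat -> bool) (beta : nat -> nat) (q : R) (n : nat) (l : list nat) :
  layer_sum g beta q (S n) l = layer_sum g beta q n l +
    q ^ n * INR (length (filter (fun m => andb (g m) (beta m =? n)%nat) l)).
Proof.
  unfold layer_sum. induction l as [|a l IH]; cbn [map fold_right filter]; [simpl; ring|].
  rewrite IH. destruct (g a); cbn [andb]; [|ring].
  destruct (Nat.eqb_spec (beta a) n) as [->|Hn].
  - replace (n <? S n)%nat with true by (symmetry; apply Nat.ltb_lt; lia).
    rewrite Nat.ltb_irrefl. cbn [length]. rewrite S_INR. ring.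
  - destruct (Nat.ltb_spec (beta a) n), (Nat.ltb_spec (beta a) (S n)); try lia; ring.
Qed.

Lemma layer_sum_zero (g : nat -> bool) (beta : nat -> nat) (q : R) (l : list nat) :
  layer_sum g beta q 0 l = 0.
Proof.
  unfold layer_sum. induction l as [|a l IH]; simpl; auto.
  rewrite Bool.andb_false_r, IH. ring.
Qed.

Lemma layer_count_le (g : nat -> bool) (beta : nat -> nat) (c : R) (n : nat) (l : list nat) :
  (forall j, INR (length (filter (fun m => andb (g m) (beta m =? j)%nat) l)) <= c) ->
  INR (length (filter (fun m => andb (g m) (beta m <? n)%nat) l)) <= c * INR n.
Proof.
  intros Hc.
  replace (INR (length (filter (fun m => andb (g m) (beta m <? n)%nat) l)))
    with (layer_sum g beta 1 n l).
  - clear -Hc. induction n as [|n IH]; [rewrite layer_sum_zero; simpl; lra|].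
    rewrite layer_sum_succ, S_INR, pow1. specialize (Hc n). lra.
  - clear. unfold layer_sum. induction l as [|a l IH]; cbn [map fold_right filter]; auto.
    rewrite IH. destruct (andb _ _); cbn [length]; rewrite ?S_INR, ?pow1; ring.
Qed.

Lemma layer_sum_geometric (g : nat -> bool) (beta : nat -> nat) (q c : R) (l : list nat) :
  0 <= q < 1 ->
  (forall j, INR (length (filter (fun m => andb (g m) (beta m =? j)%nat) l)) <= c) ->
  fold_right Rplus 0 (map (fun m => if g m then q ^ beta m else 0) l) <= c / (1 - q).
Proof.
  intros Hq Hc. assert (H0 : 0 <= c) by (eapply Rle_trans; [apply pos_INR|apply (Hc 0%nat)]).
  assert (Hn : forall n, layer_sum g beta q n l * (1 - q) <= c * (1 - q ^ n)).
  { induction n as [|n IH].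
    - rewrite layer_sum_zero. simpl. lra.
    - rewrite layer_sum_succ. specialize (Hc n).
      set (L := INR _) in *. pose proof (pow_le q n ltac:(lra)).
      assert (q ^ n * (1 - q) * L <= q ^ n * (1 - q) * c).
      { apply Rmult_le_compat_l; auto. apply Rmult_le_pos; lra. }
      simpl pow. lra. }
  (* Truncating beyond the largest block index loses nothing. *)
  replace (map (fun m => if g m then q ^ beta m else 0) l)
    with (map (fun m => if andb (g m) (beta m <? S (list_max (map beta l)))%nat
                        then q ^ beta m else 0) l).
  - specialize (Hn (S (list_max (map beta l)))). unfold layer_sum in Hn.
    pose proof (pow_le q (S (list_max (map beta l))) ltac:(lra)).
    apply Rmult_le_reg_r with (1 - q); [lra|].
    replace (c / (1 - q) * (1 - q)) with c by (field; lra).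
    eapply Rle_trans; [exact Hn|]. nra.
  - apply map_ext_in. intros m Hm.
    replace (beta m <? S (list_max (map beta l)))%nat with true;
      [now rewrite Bool.andb_true_r|].
    symmetry. apply Nat.ltb_lt, Nat.lt_succ_r.
    pose proof (proj1 (list_max_le (map beta l) _) (Nat.le_refl _)) as Hf.
    rewrite Forall_forall in Hf. apply Hf, in_map, Hm.
Qed.

Lemma sumN_plus (N : nat) (f g : nat -> R) :
  sumN N (fun m => f m + g m) = sumN N f + sumN N g.
Proof. unfold sumN. induction (seq 1 N); simpl; lra. Qed.

Lemma sumN_scal (N : nat) (c : R) (f : nat -> R) :
  sumN N (fun m => c * f m) = c * sumN N f.
Proof. unfold sumN. induction (seq 1 N); simpl; lra. Qed.

(** Shannon entropy is at least min-entropy, which is at least log2 w. *)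
Lemma block_decay_le_entropy (N : nat) (P : nat -> R) (w : R) :
  is_dist N P -> block_decay N P w -> w <= Rpower 2 (entropy N P).
Proof.
  intros [H0 H1] (Hw & Hle & _).
  rewrite <- (Rpower2_log2 w) by lra. apply Rle_Rpower; [lra|].
  replace (log2 w) with (log2 w * sumN N P) by (rewrite H1; ring).
  rewrite <- sumN_scal. unfold entropy. apply sumN_le. intros m Hm.
  destruct (Req_EM_T (P m) 0) as [->|Hne]; [lra|].
  specialize (H0 m Hm). specialize (Hle m Hm). rewrite Rmult_comm.
  apply Rmult_le_compat_l; auto. apply log2_le; [lra|].
  rewrite <- (Rinv_inv w). apply Rinv_le_contravar; lra.
Qed.

Lemma log_star_pos (N : nat) : (2 <= N)%nat -> (1 <= log_star N)%nat.
Proof.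
  intros HN. unfold log_star. destruct N as [|N]; [lia|]. cbn [log_star_aux].
  destruct (Rle_dec (INR (S N)) 1) as [H|]; [|lia].
  apply (INR_le _ 1) in H. lia.
Qed.

Lemma Rceil_ge (x : R) : x <= Rceil x.
Proof. unfold Rceil. rewrite opp_IZR. pose proof (base_Int_part (- x)). lra. Qed.

Lemma Rceil_ge_1 (x : R) : 0 < x -> 1 <= Rceil x.
Proof.
  intros Hx. pose proof (Rceil_ge x). unfold Rceil in *. apply IZR_le.
  apply Z.lt_pred_le. simpl. apply lt_IZR. lra.
Qed.

(** The codeword has at most k + 26 d + 7 bits by [bits_log_star]. With k <= 1 + r + x + w and d <=
    6 w (x + 4 r + 2), where x = - log2 (w Pt(m)), the constants follow from 26 * 6 = 156 and w >=
    1. *)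
Lemma encode_length (N : nat) (Delta r w : R) (P Pt : nat -> R) (beta : nat -> nat) (m : nat) :
  (1 <= N)%nat -> 0 <= Delta -> r = Delta * INR (log_star N) -> 1 <= w ->
  is_dist N P -> close N r P Pt ->
  (forall m, inN N m -> 0 < Pt m -> Pt m <= / w * (/ 2) ^ beta m) ->
  (forall j, INR (length (filter (fun m => andb (posb (Pt m)) (beta m =? j)%nat)
                             (seq 1 N))) <= 6 * w) ->
  inN N m -> 0 < P m -> 0 < Pt m -> Pt m <= / w ->
  INR (length (encode N Delta P m)) <=
    w * (157 * (- log2 (w * Pt m)) + 625 * r + 321).
Proof.
  intros HN HD Er Hw HP Hcl Hbeta Hcount Hm Hpos Hpt Hle.
  assert (Hr : 0 <= r) by (rewrite Er; apply Rmult_le_pos; auto using pos_INR).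
  unfold encode. destruct (Rle_dec (P m) 0) as [|_]; [lra|]. cbv zeta.
  set (t := log_star N) in *. set (rho := Rpower 2 (- (2 * Delta))).
  destruct (threshold_exponent_spec (P m)) as [Hk1 Hk2].
  { split; auto. eapply dist_le_1; eauto. }
  set (k := threshold_exponent (P m)) in *.
  set (v := level_vector N t (/ 2 ^ k) rho P). set (d := cnt t v).
  set (x := - log2 (w * Pt m)).
  assert (Ex : log2 (Pt m) = - x - log2 w).
  { unfold x. rewrite log2_mult by lra. ring. }
  assert (HlogP : log2 (Pt m) - r <= log2 (P m)).
  { destruct (Hcl m Hm) as [_ H]. apply log2_le in H; auto.
    rewrite log2_mult, log2_Rpower2 in H by auto using Rpower2_pos. lra. }
  assert (Hx : 0 <= x).
  { unfold x. pose proof (Rmult_le_compat_l w _ _ ltac:(lra) Hle) as H.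
    rewrite Rinv_r in H by lra.
    apply log2_le in H; [|apply Rmult_lt_0_compat; lra]. rewrite log2_1 in H. lra. }
  assert (Hlw : log2 w <= w) by (apply log2_le_id; lra).
  assert (Hk : INR k <= 1 + r + x + w) by lra.
  (* A message counted by d lies in a block of index at most x + 4 r + 1: the t levels contribute 2
     r, and passing between P and Pt, once at m and once at m', contributes r each. *)
  set (n := Z.to_nat (up (x + 4 * r + 1))).
  assert (Hn : x + 4 * r + 1 < INR n <= x + 4 * r + 2).
  { unfold n. destruct (archimed (x + 4 * r + 1)).
    rewrite INR_IZR_INZ, Z2Nat.id; [lra|]. apply le_IZR. lra. }
  assert (Hrho : 0 < rho <= 1).
  { unfold rho. split; [apply Rpower2_pos|]. rewrite <- (Rpower_O 2) by lra.
    apply Rle_Rpower; lra. }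
  assert (H2k : 0 < / 2 ^ k) by (apply Rinv_0_lt_compat, pow_lt; lra).
  assert (Hd : INR d <= 6 * w * INR n).
  { eapply Rle_trans; [apply le_INR|apply layer_count_le, Hcount].
    apply level_vector_cnt; [lra|auto|].
    intros m' Hm' Hge. destruct (Hcl m' Hm') as [H _].
    assert (Hrt : 0 < / 2 ^ k * rho ^ t)
      by (apply Rmult_lt_0_compat; auto; apply pow_lt; lra).
    assert (Hp' : 0 < P m') by lra.
    assert (Hpt' : 0 < Pt m').
    { pose proof (Rpower2_pos r). nra. }
    unfold posb. destruct (Rlt_dec 0 (Pt m')) as [_|]; [|tauto]. cbn [andb].
    apply Nat.ltb_lt, INR_lt. eapply Rle_lt_trans; [|apply Hn].
    apply log2_le in H; auto.
    rewrite log2_mult, log2_Rpower2 in H by auto using Rpower2_pos.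
    apply log2_le in Hge; auto.
    unfold rho in Hge.
    rewrite <- (Rpower_pow t (Rpower 2 _)), Rpower_mult in Hge by apply Rpower2_pos.
    rewrite log2_mult, log2_Rpower2, log2_inv, log2_pow2 in Hge
      by auto using Rpower2_pos, pow_lt, Rlt_0_2.
    replace (- (2 * Delta) * INR t) with (- 2 * r) in Hge by (rewrite Er; ring).
    specialize (Hbeta m' Hm' Hpt'). apply log2_le in Hbeta; auto.
    rewrite pow_inv in Hbeta.
    assert (0 < 2 ^ beta m') by (apply pow_lt; lra).
    rewrite log2_mult, !log2_inv, log2_pow2 in Hbeta
      by (try apply Rinv_0_lt_compat; lra).
    lra. }
  assert (Hd1 : (1 <= d)%nat).
  { unfold d, cnt.
    assert (Hin : In 0%nat (filter (fun a => (a <=? t)%nat) v)).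
    { apply filter_In. split; auto. unfold v, level_vector. apply in_map_iff.
      exists m. split; [apply lev_zero; auto|]. apply in_seq. unfold inN in Hm. lia. }
    destruct (filter _ v); [destruct Hin|simpl; lia]. }
  pose proof (bits_log_star N d HN Hd1) as Hb. fold t in Hb.
  unfold unary, binary. cbn [length]. rewrite !length_app, !repeat_length, length_map, length_seq.
  cbn [length]. rewrite S_INR, !plus_INR. change (INR 1) with 1.
  assert (INR d <= 6 * w * (x + 4 * r + 2)).
  { eapply Rle_trans; [exact Hd|]. apply Rmult_le_compat_l; lra. }
  assert (0 <= x * (w - 1)) by (apply Rmult_le_pos; lra).
  assert (0 <= r * (w - 1)) by (apply Rmult_le_pos; lra).
  lra.
Qed.

Lemma encode_exp_len (N : nat) (Delta w : R) (P Pt : nat -> R) :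
  (2 <= N)%nat -> 0 < Delta -> is_dist N P ->
  block_decay N Pt w -> close N (Delta * INR (log_star N)) P Pt ->
  exp_len N (encode N Delta) P <= 9000 * w * Rceil (Delta * INR (log_star N)).
Proof.
  intros HN HD HP (Hw & Hle & beta & Hbeta & Hcount) Hcl.
  remember (Delta * INR (log_star N)) as r eqn:Er.
  assert (Hr : 0 < r).
  { rewrite Er. apply Rmult_lt_0_compat; auto. apply lt_0_INR.
    pose proof (log_star_pos N HN). lia. }
  (* Half of the decay pays for the factor x: w Pt(m) 2^(x/2) is the square root of w Pt(m), hence
     at most q^(beta m), and this is still summable over blocks. *)
  set (q := Rpower 2 (- / 2)).
  assert (Hq0 : 0 < q) by apply Rpower2_pos.
  assert (Hq : q <= 3 / 4).
  { assert (q * q = / 2).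
    { unfold q. rewrite <- Rpower_plus. replace (- / 2 + - / 2) with (- (1)) by field.
      rewrite Rpower_Ropp, Rpower_1; lra. }
    nra. }
  set (e := fun m => if posb (Pt m) then q ^ beta m else 0).
  assert (He : sumN N e <= 24 * w).
  { eapply Rle_trans; [apply layer_sum_geometric with (c := 6 * w); auto; lra|].
    apply Rmult_le_reg_r with (1 - q); [lra|].
    unfold Rdiv. rewrite Rmult_assoc, Rinv_l by lra. nra. }
  (* Splitting 157 x as 157 (x - 2 r) + 314 r gives 625 + 314 = 939. After summation, 314 * 24 + 321
     = 7857, and 7857 + 939 is below 9000. *)
  assert (Hpt : forall m, inN N m ->
    P m * INR (length (encode N Delta P m)) <= 314 * e m + (w * (939 * r + 321)) * P m).
  { intros m Hm. assert (Hpm := proj1 HP m Hm).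
    assert (He0 : 0 <= e m).
    { unfold e. destruct (posb (Pt m)); [apply pow_le|]; lra. }
    destruct (Req_dec (P m) 0) as [E|E]; [rewrite E; lra|].
    assert (Hpos : 0 < P m) by lra. destruct (Hcl m Hm) as [Hc _].
    assert (Hptm : 0 < Pt m) by (pose proof (Rpower2_pos r); nra).
    pose proof (encode_length N Delta r w P Pt beta m ltac:(lia) ltac:(lra) Er Hw HP
                  Hcl Hbeta Hcount Hm Hpos Hptm (Hle m Hm)) as HL.
    set (x := - log2 (w * Pt m)) in *.
    (* x - 2r <= 2 * 2^((x-2r)/2), and P m <= 2^r Pt m absorbs the factor 2^-r. *)
    assert (Hmain : w * (P m * (x - 2 * r)) <= 2 * e m).
    { assert (H1 : x - 2 * r <= 2 * (Rpower 2 (- r) * Rpower 2 (x * / 2))).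
      { rewrite <- Rpower_plus. pose proof (Rpower2_ge_id (- r + x * / 2)). lra. }
      assert (H2 : P m * Rpower 2 (- r) <= Pt m).
      { apply (Rmult_le_compat_r (Rpower 2 (- r))) in Hc;
          [|left; apply Rpower2_pos].
        replace (Rpower 2 r * Pt m * Rpower 2 (- r))
          with (Rpower 2 r * Rpower 2 (- r) * Pt m) in Hc by ring.
        rewrite <- Rpower_plus, Rplus_opp_r, Rpower_O in Hc by lra. lra. }
      assert (H3 : w * Pt m * Rpower 2 (x * / 2) <= e m).
      { rewrite <- (Rpower2_log2 (w * Pt m)) by (apply Rmult_lt_0_compat; lra).
        rewrite <- Rpower_plus. unfold e, posb.
        destruct (Rlt_dec 0 (Pt m)); [|tauto].
        rewrite <- Rpower_pow by auto. unfold q. rewrite Rpower_mult.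
        apply Rle_Rpower; [lra|].
        specialize (Hbeta m Hm Hptm). apply log2_le in Hbeta; auto.
        rewrite pow_inv in Hbeta.
        assert (0 < 2 ^ beta m) by (apply pow_lt; lra).
        rewrite log2_mult, !log2_inv, log2_pow2 in Hbeta
          by (try apply Rinv_0_lt_compat; lra).
        unfold x. rewrite log2_mult by lra. lra. }
      pose proof (Rpower2_pos (x * / 2)) as Hy. set (y := Rpower 2 (x * / 2)) in *.
      apply (Rmult_le_compat_l (P m)) in H1; [|lra].
      apply (Rmult_le_compat_r y) in H2; [|lra].
      apply (Rmult_le_compat_l w) in H1, H2; try lra. }
    apply (Rmult_le_compat_l (P m)) in HL; [|lra]. lra. }
  unfold exp_len. eapply Rle_trans; [apply sumN_le, Hpt|].
  rewrite sumN_plus, !sumN_scal. destruct HP as [_ ->].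
  pose proof (Rceil_ge r). pose proof (Rceil_ge_1 r Hr).
  assert (w * (7857 + 939 * r) <= w * (9000 * Rceil r)) by (apply Rmult_le_compat_l; lra).
  lra.
Qed.

(** * Decay of flat, geometric and binomial distributions *)

Lemma flat_block_decay (N : nat) (P : nat -> R) :
  Flat N P -> exists w, block_decay N P w.
Proof.
  intros [HP (S & Hne & Hnd & Hin & Hval)].
  assert (HS : 1 <= INR (length S)).
  { apply (le_INR 1). destruct S; [congruence|simpl; lia]. }
  assert (Hsup : forall m, inN N m -> P m <= / INR (length S)).
  { intros m Hm. destruct (Hval m Hm) as [H1 H2].
    destruct (in_dec Nat.eq_dec m S) as [H|H]; [rewrite H1 by auto; lra|].
    rewrite H2 by auto. left. apply Rinv_0_lt_compat. lra. }
  exists (INR (length S)). repeat split; auto.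
  exists (fun _ => 0%nat). split.
  - intros m Hm _. rewrite pow_O, Rmult_1_r. auto.
  - intros j. apply Rle_trans with (INR (length S)); [|lra].
    apply le_INR, NoDup_incl_length; [apply NoDup_filter, seq_NoDup|].
    intros m Hm. apply filter_In in Hm. destruct Hm as [Hm Hp].
    apply andb_prop in Hp. destruct Hp as [Hp _].
    apply in_seq in Hm. destruct (Hval m ltac:(unfold inN; lia)) as [_ H2].
    destruct (in_dec Nat.eq_dec m S) as [H|H]; auto. rewrite H2 in Hp by auto.
    unfold posb in Hp. destruct (Rlt_dec 0 0); [lra|discriminate].
Qed.

Lemma uniform_mass_le (N : nat) (P : nat -> R) (l : list nat) (c : R) :
  is_dist N P -> 0 <= c -> NoDup l -> (forall x, In x l -> inN N x /\ c <= P x) ->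
  INR (length l) * c <= 1.
Proof.
  intros [H0 H1] Hc Hnd Hl. rewrite <- H1.
  set (p := fun m => if in_dec Nat.eq_dec m l then true else false).
  apply Rle_trans with (INR (length (filter p (seq 1 N))) * c).
  - apply Rmult_le_compat_r; auto. apply le_INR, NoDup_incl_length; auto.
    intros x Hx. apply filter_In. destruct (Hl x Hx) as [Hx' _]. unfold inN in Hx'.
    split; [apply in_seq; lia|]. unfold p. destruct (in_dec Nat.eq_dec x l); tauto.
  - unfold sumN. clear Hnd H1.
    assert (Hs : forall m, In m (seq 1 N) -> 0 <= P m).
    { intros m Hm. apply in_seq in Hm. apply H0. unfold inN. lia. }
    induction (seq 1 N) as [|a s IH]; [simpl; lra|].
    cbn [filter map fold_right]. specialize (IH (fun m Hm => Hs m (or_intror Hm))).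
    pose proof (Hs a (or_introl eq_refl)).
    unfold p at 1. destruct (in_dec Nat.eq_dec a l) as [Ha|Ha]; [|lra].
    cbn [length]. rewrite S_INR. destruct (Hl a Ha). lra.
Qed.

Definition log_concave (g : nat -> R) (n : nat) : Prop :=
  (forall i, (i <= n)%nat -> 0 < g i) /\
  (forall i, (i + 2 <= n)%nat -> g i * g (i + 2)%nat <= g (i + 1)%nat ^ 2).

(** Successive ratios g(i+1)/g(i) do not increase; cross-multiplied to avoid division. *)
Lemma log_concave_ratio (g : nat -> R) (n j k : nat) :
  log_concave g n -> (j + k + 1 <= n)%nat ->
  g (j + k + 1)%nat * g j <= g (j + 1)%nat * g (j + k)%nat.
Proof.
  intros [g_pos g_lc]. induction k as [|k IH]; intros H.
  - rewrite !Nat.add_0_r. lra.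
  - specialize (IH ltac:(lia)). pose proof (g_lc (j + k)%nat ltac:(lia)) as Hlc.
    replace (j + S k + 1)%nat with (j + k + 2)%nat by lia.
    replace (j + S k)%nat with (j + k + 1)%nat by lia.
    pose proof (g_pos (j + k)%nat ltac:(lia)). pose proof (g_pos j ltac:(lia)).
    pose proof (g_pos (j + k + 1)%nat ltac:(lia)).
    apply Rmult_le_reg_l with (g (j + k)%nat); auto.
    apply Rmult_le_compat_r with (r := g j) in Hlc; [|lra].
    apply Rmult_le_compat_l with (r := g (j + k + 1)%nat) in IH; [|lra].
    lra.
Qed.

(** Product of s ratio inequalities: g(b+s)/g(b) <= g(s)/g(0), so s steps lose at least as large a
    factor from b as from 0. *)
Lemma log_concave_shift (g : nat -> R) (n b s : nat) :
  log_concave g n -> (b + s <= n)%nat ->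
  g (b + s)%nat * g 0%nat <= g s * g b.
Proof.
  intros Hg. pose proof (proj1 Hg) as g_pos. induction s as [|s IH]; intros H.
  - rewrite Nat.add_0_r. lra.
  - specialize (IH ltac:(lia)).
    pose proof (log_concave_ratio g n s b Hg ltac:(lia)) as Hr.
    replace (s + b + 1)%nat with (b + S s)%nat in Hr by lia.
    replace (s + b)%nat with (b + s)%nat in Hr by lia.
    replace (s + 1)%nat with (S s) in Hr by lia.
    pose proof (g_pos s ltac:(lia)). pose proof (g_pos (b + s)%nat ltac:(lia)).
    pose proof (g_pos (S s)%nat ltac:(lia)). pose proof (g_pos 0%nat ltac:(lia)).
    apply Rmult_le_reg_l with (g s * g (b + s)%nat); [apply Rmult_lt_0_compat; auto|].
    apply Rmult_le_compat_r with (r := g (b + s)%nat * g 0%nat) in Hr;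
      [|apply Rmult_le_pos; lra].
    apply Rmult_le_compat_l with (r := g (S s) * g (b + s)%nat) in IH;
      [|apply Rmult_le_pos; lra].
    lra.
Qed.

Lemma log_concave_decreasing (g : nat -> R) (n i j : nat) :
  log_concave g n -> (forall i, (i <= n)%nat -> g i <= g 0%nat) ->
  (i <= j <= n)%nat -> g j <= g i.
Proof.
  intros Hg g_max [Hij Hj]. pose proof (proj1 Hg) as g_pos. induction Hij as [|j Hij IH]; [lra|].
  specialize (IH ltac:(lia)).
  pose proof (log_concave_shift g n j 1 Hg ltac:(lia)) as H. rewrite Nat.add_1_r in H.
  pose proof (g_max 1%nat ltac:(lia)). pose proof (g_pos j ltac:(lia)).
  pose proof (g_pos 0%nat ltac:(lia)).
  assert (g (S j) <= g j); [|lra].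
  apply Rmult_le_reg_r with (g 0%nat); auto.
  apply Rmult_le_compat_r with (r := g j) in H0; lra.
Qed.

(** By [log_concave_shift], a halving over the first s steps repeats over every later s steps. If s
    > n, all exponents are 0. *)
Lemma log_concave_decay (g : nat -> R) (n s : nat) :
  log_concave g n -> (forall i, (i <= n)%nat -> g i <= g 0%nat) -> (1 <= s)%nat ->
  ((s <= n)%nat -> g s <= g 0%nat * / 2) ->
  forall i, (i <= n)%nat -> g i <= g 0%nat * (/ 2) ^ (i / s).
Proof.
  intros Hg g_max Hs Hhalf i. pose proof (proj1 Hg) as g_pos.
  induction i as [i IH] using lt_wf_ind. intros Hi.
  destruct (Nat.lt_ge_cases i s) as [H|H].
  - rewrite Nat.div_small by auto. rewrite pow_O, Rmult_1_r. auto.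
  - specialize (IH (i - s)%nat ltac:(lia) ltac:(lia)). specialize (Hhalf ltac:(lia)).
    pose proof (log_concave_shift g n (i - s) s Hg ltac:(lia)) as Hsh.
    replace (i - s + s)%nat with i in Hsh by lia.
    replace (i / s)%nat with (S ((i - s) / s)).
    + pose proof (g_pos 0%nat ltac:(lia)). pose proof (g_pos (i - s)%nat ltac:(lia)).
      assert (g i <= / 2 * g (i - s)%nat).
      { apply Rmult_le_reg_r with (g 0%nat); auto.
        apply Rmult_le_compat_r with (r := g (i - s)%nat) in Hhalf; lra. }
      simpl pow. lra.
    + replace i with ((i - s) + 1 * s)%nat at 2 by lia.
      rewrite Nat.div_add by lia. lia.
Qed.

(* The values above half the maximum carry mass at most 1, so they number at
   most 2 / P (tau 0). *)
Lemma dist_log_concave_decay (N n s : nat) (P : nat -> R) (tau : nat -> nat) :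
  is_dist N P ->
  (forall i, (i <= n)%nat -> inN N (tau i) /\ 0 < P (tau i) <= P (tau 0%nat)) ->
  (forall i j, (i <= n)%nat -> (j <= n)%nat -> tau i = tau j -> i = j) ->
  (forall i, (i + 2 <= n)%nat ->
     P (tau i) * P (tau (i + 2)%nat) <= P (tau (i + 1)%nat) ^ 2) ->
  (1 <= s)%nat -> 2 * / P (tau 0%nat) <= INR s ->
  forall i, (i <= n)%nat -> P (tau i) <= P (tau 0%nat) * (/ 2) ^ (i / s).
Proof.
  intros HP Hin Hinj Hlc Hs HsM.
  set (g := fun i => P (tau i)).
  change (forall i, (i <= n)%nat -> g i <= g 0%nat * (/ 2) ^ (i / s)).
  assert (Hpos : forall i, (i <= n)%nat -> 0 < g i) by (intros; apply Hin; auto).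
  assert (Hmax : forall i, (i <= n)%nat -> g i <= g 0%nat) by (intros; apply Hin; auto).
  assert (Hg : log_concave g n) by (split; auto).
  apply log_concave_decay; auto. intros Hsn.
  assert (Hmass : INR (length (map tau (seq 0 (S s)))) * g s <= 1).
  { apply uniform_mass_le with (N := N) (P := P); auto.
    - left. auto.
    - apply NoDup_map_NoDup_ForallPairs; [|apply seq_NoDup].
      intros a b Ha Hb. apply in_seq in Ha, Hb. apply Hinj; lia.
    - intros x Hx. apply in_map_iff in Hx. destruct Hx as (i & <- & Hi).
      apply in_seq in Hi. split; [apply Hin; lia|].
      apply (log_concave_decreasing g n); auto. lia. }
  rewrite length_map, length_seq, S_INR in Hmass.
  pose proof (Hpos 0%nat ltac:(lia)) as H0. pose proof (Hpos s Hsn) as Hps.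
  change (P (tau 0%nat)) with (g 0%nat) in HsM.
  apply Rmult_le_compat_r with (r := g 0%nat) in HsM; [|lra].
  rewrite Rmult_assoc, Rinv_l, Rmult_1_r in HsM by lra.
  apply Rmult_le_compat_r with (r := g s) in HsM; [|lra].
  apply Rmult_le_compat_r with (r := g 0%nat) in Hmass; [|lra].
  assert (0 <= g s * g 0%nat) by (apply Rmult_le_pos; lra).
  lra.
Qed.

Lemma injection_surjective (N : nat) (sigma : nat -> nat) :
  (forall k, (k < N)%nat -> inN N (sigma k)) ->
  (forall k l, (k < N)%nat -> (l < N)%nat -> sigma k = sigma l -> k = l) ->
  forall m, inN N m -> exists k, (k < N)%nat /\ sigma k = m.
Proof.
  intros Hin Hinj m Hm.
  assert (H : incl (seq 1 N) (map sigma (seq 0 N))).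
  { apply NoDup_length_incl.
    - apply NoDup_map_NoDup_ForallPairs; [|apply seq_NoDup].
      intros a b Ha Hb. apply in_seq in Ha, Hb. apply Hinj; lia.
    - now rewrite length_map, !length_seq.
    - intros x Hx. apply in_map_iff in Hx. destruct Hx as (i & <- & Hi).
      apply in_seq in Hi. specialize (Hin i ltac:(lia)). unfold inN in Hin.
      apply in_seq. lia. }
  unfold inN in Hm. specialize (H m ltac:(apply in_seq; lia)).
  apply in_map_iff in H. destruct H as (k & E & Hk). apply in_seq in Hk.
  exists k. split; [lia|auto].
Qed.

Lemma argmax_exists (f : nat -> R) (N : nat) : (1 <= N)%nat ->
  exists k0, (k0 < N)%nat /\ forall k, (k < N)%nat -> f k <= f k0.
Proof.
  induction 1 as [|N HN (k0 & Hk0 & H)].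
  - exists 0%nat. split; [lia|]. intros k Hk. replace k with 0%nat by lia. lra.
  - destruct (Rle_lt_dec (f N) (f k0)) as [Hle|Hlt].
    + exists k0. split; [lia|]. intros k Hk.
      destruct (Nat.eq_dec k N) as [->|]; auto. apply H. lia.
    + exists N. split; [lia|]. intros k Hk.
      destruct (Nat.eq_dec k N) as [->|]; [lra|]. specialize (H k ltac:(lia)). lra.
Qed.

(** The decay estimate is applied on both sides of a mode k0, to the sequences running right and
    left from it. Blocks are cut by distance from k0, in units of s, which is about 2/M for the
    maximum M. *)
Lemma log_concave_block_decay (N : nat) (P : nat -> R) (sigma : nat -> nat) :
  (1 <= N)%nat -> is_dist N P ->
  (forall k, (k < N)%nat -> inN N (sigma k)) ->
  (forall k l, (k < N)%nat -> (l < N)%nat -> sigma k = sigma l -> k = l) ->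
  (forall k, (k < N)%nat -> 0 < P (sigma k)) ->
  (forall k, (k + 2 < N)%nat ->
     P (sigma k) * P (sigma (k + 2)%nat) <= P (sigma (k + 1)%nat) ^ 2) ->
  exists w, block_decay N P w.
Proof.
  intros HN HP Hin Hinj Hpos Hlc.
  pose proof (injection_surjective N sigma Hin Hinj) as Hsurj.
  destruct (argmax_exists (fun k => P (sigma k)) N HN) as (k0 & Hk0 & Hmax).
  cbv beta in Hmax.
  set (M := P (sigma k0)) in *.
  assert (HM : 0 < M <= 1).
  { split; [apply Hpos; auto|]. apply dist_le_1 with (N := N); auto. }
  assert (Hw : 1 <= / M) by (rewrite <- Rinv_1; apply Rinv_le_contravar; lra).
  set (s := Z.to_nat (up (2 * / M))).
  assert (Hs : 2 * / M <= INR s <= 2 * / M + 1).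
  { unfold s. destruct (archimed (2 * / M)).
    rewrite INR_IZR_INZ, Z2Nat.id; [lra|]. apply le_IZR. lra. }
  assert (Hs1 : (1 <= s)%nat) by (apply INR_le; change (INR 1) with 1; lra).
  set (inv := fun m => epsilon (inhabits 0%nat) (fun k => (k < N)%nat /\ sigma k = m)).
  assert (Hinv : forall m, inN N m -> (inv m < N)%nat /\ sigma (inv m) = m).
  { intros m Hm. unfold inv. apply epsilon_spec. auto. }
  set (beta := fun m => (((inv m - k0) + (k0 - inv m)) / s)%nat).
  exists (/ M). repeat split; auto.
  - intros m Hm. rewrite Rinv_inv. destruct (Hinv m Hm) as [H <-]. auto.
  - exists beta. split.
    + intros m Hm _. rewrite Rinv_inv. destruct (Hinv m Hm) as [Hk E].
      rewrite <- E at 1. unfold beta. set (k := inv m) in *.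
      destruct (Nat.le_ge_cases k0 k) as [H|H].
      * replace (k0 - k)%nat with 0%nat by lia. rewrite Nat.add_0_r.
        set (tau := fun i => sigma (k0 + i)%nat).
        assert (Et : tau 0%nat = sigma k0) by (unfold tau; now rewrite Nat.add_0_r).
        unfold M. rewrite <- Et. replace k with (k0 + (k - k0))%nat at 1 by lia.
        change (sigma (k0 + (k - k0))%nat) with (tau (k - k0)%nat).
        apply (dist_log_concave_decay N (N - 1 - k0)); auto; try lia;
          unfold tau in *; rewrite ?Et.
        -- intros i Hi. split; [|split]; [apply Hin|apply Hpos|apply Hmax]; lia.
        -- intros i j Hi Hj Eij. apply Hinj in Eij; lia.
        -- intros i Hi. rewrite !Nat.add_assoc. apply Hlc. lia.
        -- apply Hs.
      * replace (k - k0)%nat with 0%nat by lia. rewrite Nat.add_0_l.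
        set (tau := fun i => sigma (k0 - i)%nat).
        assert (Et : tau 0%nat = sigma k0) by (unfold tau; now rewrite Nat.sub_0_r).
        unfold M. rewrite <- Et. replace k with (k0 - (k0 - k))%nat at 1 by lia.
        change (sigma (k0 - (k0 - k))%nat) with (tau (k0 - k)%nat).
        apply (dist_log_concave_decay N k0); auto; try lia;
          unfold tau in *; rewrite ?Et.
        -- intros i Hi. split; [|split]; [apply Hin|apply Hpos|apply Hmax]; lia.
        -- intros i j Hi Hj Eij. apply Hinj in Eij; lia.
        -- intros i Hi. specialize (Hlc (k0 - (i + 2))%nat ltac:(lia)).
           replace (k0 - (i + 2) + 2)%nat with (k0 - i)%nat in Hlc by lia.
           replace (k0 - (i + 2) + 1)%nat with (k0 - (i + 1))%nat in Hlc by lia.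
           lra.
        -- apply Hs.
    (* A block has at most s positions on each side of the mode, and 2 s <= 2 (2 w + 1) <= 6 w since
       w >= 1. *)
    + intros j. apply Rle_trans with (INR (2 * s));
        [|rewrite mult_INR; change (INR 2) with 2; lra].
      apply le_INR. set (l := filter _ _).
      assert (Hl : forall m, In m l -> inN N m /\ beta m = j).
      { intros m Hm. apply filter_In in Hm. destruct Hm as [Hm Hb].
        apply andb_prop in Hb. destruct Hb as [_ Hb]. apply Nat.eqb_eq in Hb.
        apply in_seq in Hm. split; auto. unfold inN. lia. }
      rewrite <- (length_map inv l).
      replace (2 * s)%nat with (length (map (fun i => (k0 + (j * s + i))%nat) (seq 0 s) ++
        map (fun i => (k0 - (j * s + i))%nat) (seq 0 s)))
        by (rewrite length_app, !length_map, length_seq; lia).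
      apply NoDup_incl_length.
      * apply NoDup_map_NoDup_ForallPairs; [|apply NoDup_filter, seq_NoDup].
        intros a b Ha Hb E. destruct (Hinv a) as [_ Ea]; [apply Hl; auto|].
        destruct (Hinv b) as [_ Eb]; [apply Hl; auto|]. congruence.
      * intros k Hk. apply in_map_iff in Hk. destruct Hk as (m & <- & Hm).
        destruct (Hl m Hm) as [_ Hb]. unfold beta in Hb.
        set (k := inv m) in *. set (x := ((k - k0) + (k0 - k))%nat) in *.
        pose proof (Nat.div_mod_eq x s) as Ex. rewrite Hb in Ex.
        pose proof (Nat.mod_upper_bound x s ltac:(lia)) as Hx.
        apply in_or_app. destruct (Nat.le_ge_cases k0 k) as [H|H].
        -- left. apply in_map_iff. exists (x mod s)%nat. split; [|apply in_seq; lia].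
           unfold x in *. nia.
        -- right. apply in_map_iff. exists (x mod s)%nat. split; [|apply in_seq; lia].
           unfold x in *. nia.
Qed.

Lemma geo_block_decay (N : nat) (P : nat -> R) :
  (1 <= N)%nat -> Geo N P -> exists w, block_decay N P w.
Proof.
  intros HN [HP (alpha & pi & Ha & [Hin Hinj] & Hgeo)].
  set (sigma := fun k => pi (S k)).
  assert (Hin' : forall k, (k < N)%nat -> inN N (sigma k)).
  { intros k Hk. apply Hin. unfold inN. lia. }
  assert (Hinj' : forall k l, (k < N)%nat -> (l < N)%nat -> sigma k = sigma l -> k = l).
  { intros k l Hk Hl E. apply Hinj in E; unfold inN; lia. }
  assert (Hstep : forall k, (k + 1 < N)%nat -> P (sigma (k + 1)%nat) = alpha * P (sigma k)).
  { intros k Hk. unfold sigma. rewrite Nat.add_1_r. apply Hgeo. lia. }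
  (* If the first value were 0, the recurrence would make all values 0, contradicting total mass
     1. *)
  assert (H0 : 0 < P (sigma 0%nat)).
  { destruct (proj1 HP (sigma 0%nat) ltac:(apply Hin'; lia)) as [|E]; auto. exfalso.
    assert (Hz : forall k, (k < N)%nat -> P (sigma k) = 0).
    { induction k as [|k IH]; intros Hk; [auto|].
      rewrite <- Nat.add_1_r, Hstep, IH by lia. ring. }
    assert (sumN N P <= sumN N (fun m => 0 * P m)).
    { apply sumN_le. intros m Hm.
      destruct (injection_surjective N sigma Hin' Hinj' m Hm) as (k & Hk & <-).
      rewrite Hz by auto. lra. }
    rewrite sumN_scal in H. destruct HP as [_ H1]. lra. }
  apply (log_concave_block_decay N P sigma); auto.
  - induction k as [|k IH]; intros Hk; auto.
    rewrite <- Nat.add_1_r, Hstep by lia. apply Rmult_lt_0_compat; [lra|].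
    apply IH. lia.
  - intros k Hk. replace (k + 2)%nat with (k + 1 + 1)%nat by lia.
    rewrite (Hstep (k + 1)%nat), (Hstep k) by lia. right. ring.
Qed.

Lemma binomial_pmf_step (n k : nat) (p : R) : (k < n)%nat ->
  Binomial.C n (k + 1) * p ^ (k + 1) * (1 - p) ^ (n - (k + 1)) * (INR (k + 1) * (1 - p)) =
  Binomial.C n k * p ^ k * (1 - p) ^ (n - k) * (INR (n - k) * p).
Proof.
  intros Hk. unfold Binomial.C.
  replace (n - k)%nat with (S (n - (k + 1))) by lia.
  set (j := (n - (k + 1))%nat). rewrite Nat.add_1_r.
  change (fact (S k)) with (S k * fact k)%nat. change (fact (S j)) with (S j * fact j)%nat.
  rewrite !mult_INR. simpl pow.
  pose proof (INR_fact_neq_0 k). pose proof (INR_fact_neq_0 j).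
  pose proof (not_0_INR (S k) ltac:(lia)). pose proof (not_0_INR (S j) ltac:(lia)).
  field. auto.
Qed.

Lemma bin_block_decay (N : nat) (P : nat -> R) :
  (1 <= N)%nat -> Bin N P -> exists w, block_decay N P w.
Proof.
  intros HN [HP (p & pi & Hp & Hin & Hinj & Hbin)].
  assert (Hpos : forall k, (k < N)%nat -> 0 < P (pi k)).
  { intros k Hk. rewrite Hbin by auto. unfold Binomial.C.
    repeat apply Rmult_lt_0_compat; try (apply pow_lt; lra).
    - apply INR_fact_lt_0.
    - apply Rinv_0_lt_compat, Rmult_lt_0_compat; apply INR_fact_lt_0. }
  assert (Hstep : forall k, (k + 1 < N)%nat ->
    P (pi (k + 1)%nat) * (INR (k + 1) * (1 - p)) = P (pi k) * (INR (N - 1 - k) * p)).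
  { intros k Hk. rewrite !Hbin by lia. apply binomial_pmf_step. lia. }
  apply (log_concave_block_decay N P pi); auto.
  intros k Hk.
  pose proof (Hstep k ltac:(lia)) as E1. pose proof (Hstep (k + 1)%nat ltac:(lia)) as E2.
  replace (k + 1 + 1)%nat with (k + 2)%nat in E2 by lia.
  pose proof (Hpos k ltac:(lia)). pose proof (Hpos (k + 1)%nat ltac:(lia)).
  pose proof (Hpos (k + 2)%nat ltac:(lia)).
  set (x := P (pi k)) in *. set (y := P (pi (k + 1)%nat)) in *.
  set (z := P (pi (k + 2)%nat)) in *.
  assert (HA : INR (k + 2) = INR (k + 1) + 1) by (rewrite <- S_INR; f_equal; lia).
  assert (HB : INR (N - 1 - k) = INR (N - 1 - (k + 1)) + 1)
    by (rewrite <- S_INR; f_equal; lia).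
  rewrite HA in E2. rewrite HB in E1.
  pose proof (lt_0_INR (k + 1) ltac:(lia)) as Ha.
  pose proof (pos_INR (N - 1 - (k + 1))) as Hb.
  set (a := INR (k + 1)) in *. set (b := INR (N - 1 - (k + 1))) in *.
  (* K clears the denominators of the two ratios; log-concavity becomes a b <= (a + 1)(b + 1). *)
  set (K := (b + 1) * p * ((a + 1) * (1 - p))).
  assert (HK : 0 < K) by (unfold K; repeat apply Rmult_lt_0_compat; lra).
  apply Rmult_le_reg_r with (1 := HK).
  assert (E : x * z * K = y * y * (a * b * (p * (1 - p)))).
  { unfold K. replace (x * z * ((b + 1) * p * ((a + 1) * (1 - p))))
      with ((x * ((b + 1) * p)) * (z * ((a + 1) * (1 - p)))) by ring.
    rewrite <- E1, E2. ring. }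
  rewrite E. replace (y ^ 2) with (y * y) by ring.
  apply Rmult_le_compat_l; [nra|]. unfold K.
  replace ((b + 1) * p * ((a + 1) * (1 - p))) with ((b + 1) * (a + 1) * (p * (1 - p))) by ring.
  apply Rmult_le_compat_r; nra.
Qed.

Theorem mainTheorem14 :
  exists C : R,
  forall (N : nat), (2 <= N)%nat ->
  forall (Delta : R), 0 < Delta ->
  exists (E : (nat -> R) -> nat -> list bool) (D : (nat -> R) -> list bool -> nat),
    (forall P Q : nat -> R, is_dist N P -> is_dist N Q -> close N Delta P Q ->
       forall m, inN N m -> D Q (E P m) = m) /\
    (forall P : nat -> R, inF N P ->
       exp_len N E P <= C * Rpower 2 (entropy N P) * Rceil (Delta * INR (log_star N))) /\
    (forall P Pt : nat -> R, is_dist N P -> inF N Pt ->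
       close N (Delta * INR (log_star N)) P Pt ->
       exp_len N E P <= C * Rpower 2 (entropy N Pt) * Rceil (Delta * INR (log_star N))).
Proof.
  exists 9000. intros N HN Delta HD. exists (encode N Delta), (decode N Delta).
  assert (Hdist : forall P, inF N P -> is_dist N P).
  { intros P [[H _]|[[H _]|[H _]]]; exact H. }
  assert (Hr : 0 < Delta * INR (log_star N)).
  { apply Rmult_lt_0_compat; auto. apply lt_0_INR.
    pose proof (log_star_pos N HN). lia. }
  assert (Hmain : forall P Pt : nat -> R, is_dist N P -> inF N Pt ->
       close N (Delta * INR (log_star N)) P Pt ->
       exp_len N (encode N Delta) P <=
         9000 * Rpower 2 (entropy N Pt) * Rceil (Delta * INR (log_star N))).
  { intros P Pt HP HF Hcl.
    assert (exists w, block_decay N Pt w) as [w Hw].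
    { destruct HF as [H|[H|H]].
      - now apply flat_block_decay.
      - apply geo_block_decay; auto; lia.
      - apply bin_block_decay; auto; lia. }
    eapply Rle_trans; [eapply encode_exp_len; eauto|].
    pose proof (Rceil_ge_1 _ Hr).
    apply Rmult_le_compat_r; [lra|]. apply Rmult_le_compat_l; [lra|].
    apply block_decay_le_entropy; auto. }
  split; [|split; auto].
  - intros P Q HP _ HPQ m Hm. now apply decode_encode.
  (* The case Pt = P: a distribution is close to itself because 2^r >= 1. *)
  - intros P HF. apply Hmain; auto. intros m Hm.
    pose proof (proj1 (Hdist P HF) m Hm).
    assert (1 <= Rpower 2 (Delta * INR (log_star N))).
    { rewrite <- (Rpower_O 2) at 1 by lra. apply Rle_Rpower; lra. }
    split; nra.
Qed.
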